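(* Let $(X_i)_{i\in\mathbb{N}}$ be a sequence of free identically distributed self-adjoint random variables with distribution $\mu$ for some probability measure $\mu$ on $\mathbb{R}$. Assume that $\mu$ has mean zero, unit variance, and finite sixth moment. For $\theta\in\mathbb{S}^{n-1}$ denote by $\mu_\theta$ the distribution of $S_\theta=\theta_1X_1+\dots+\theta_nX_n$. Let $\varepsilon,\rho\in(0,1)$. Then there exist constants $n_{\varepsilon,\rho,\mu}\in\mathbb{N}$ and $C_{\varepsilon,\rho,\mu}>0$ (not depending on $n$) and, for each $n$, a measurable set $\mathcal{F}=\mathcal{F}_n\subset\mathbb{S}^{n-1}$ with $\sigma_{n-1}(\mathcal{F})\ge1-\rho$ such that for all $n\ge n_{\varepsilon,\rho,\mu}$ and all $\theta\in\mathcal{F}$ we have $$\Delta_\varepsilon(\mu_\theta,\omega)\le\frac{C_{\varepsilon,\rho,\mu}}{n}.$$ The constant $C_{\varepsilon,\rho,\mu}$ depends on $\varepsilon$, $\rho$, and on $\mu$ through its first six absolute moments.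
   Context: For $\varepsilon>0$ and probability measures $\nu_1,\nu_2$ on $\mathbb{R}$, the pseudometric $\Delta_\varepsilon$ is $$\Delta_\varepsilon(\nu_1,\nu_2)=\sup_{x\in[-2+\varepsilon,2-\varepsilon]}\big|\nu_1((-2+\varepsilon,x])-\nu_2((-2+\varepsilon,x])\big|.$$ $\mathbb{S}^{n-1}$ is the unit sphere of $\mathbb{R}^n$ and $\sigma_{n-1}$ is the uniform probability measure on it. $\omega$ is Wigner's semicircle law with mean zero and variance one, i.e. the measure with density $\frac{1}{2\pi}\sqrt{4-x^2}$ on $[-2,2]$. The $X_i$ are (possibly unbounded) self-adjoint random variables in a tracial noncommutative probability space, free in Voiculescu's sense. The distribution of $S_\theta$ is the free additive convolution $\mu_\theta=\mu_1\boxplus\dots\boxplus\mu_n$, where $\mu_i=D_{\theta_i}\mu$ is the push-forward of $\mu$ under $x\mapsto\theta_i x$. Analytically, with $G_\nu(z)=\int\frac{1}{z-t}\nu(dt)$ and $F_\nu=1/G_\nu$ on the upper half-plane $\mathbb{C}^+$, the measure $\nu=\nu_1\boxplus\dots\boxplus\nu_n$ is the probability measure with $F_\nu(z)=F_{\nu_1}(Z_1(z))$, where $Z_1,\dots,Z_n:\mathbb{C}^+\to\mathbb{C}^+$ are the unique holomorphic functions with $Z_1(z)+\dots+Z_n(z)-z=(n-1)F_{\nu_1}(Z_1(z))$ and $F_{\nu_1}(Z_1(z))=\dots=F_{\nu_n}(Z_n(z))$ for all $z\in\mathbb{C}^+$. *)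

(* Defs.v *)
From HB Require Import structures.
From mathcomp Require Import all_boot all_order all_algebra.
From mathcomp Require Import complex.
From mathcomp Require Import all_classical all_reals all_analysis.
From mathcomp Require Import measurable_realfun.
From mathcomp Require Import ring lra.

Set Implicit Arguments.
Unset Strict Implicit.
Unset Printing Implicit Defensive.

Import Order.TTheory GRing.Theory Num.Theory.
Import numFieldNormedType.Exports.

Local Open Scope classical_set_scope.
Local Open Scope ring_scope.

Notation probR R := (probability (measurableTypeR R) R).

Section semicircle_law.
Context {R : realType}.
Local Notation leb := (@lebesgue_measure R).

(* [Num.sqrt] is 0 on negative numbers, so this vanishes outside [-2, 2]. *)
Definition semicircle_pdf (x : R) : R := Num.sqrt (4 - x ^+ 2) / (2 * pi).

Definition semicircle (A : set (measurableTypeR R)) : \bar R :=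
  (\int[leb]_(x in A) (semicircle_pdf x)%:E)%E.

Lemma semicircle_pdf_ge0 x : 0 <= semicircle_pdf x.
Proof. by rewrite divr_ge0 ?sqrtr_ge0// mulr_ge0// pi_ge0. Qed.

Lemma continuous_semicircle_pdf : continuous semicircle_pdf.
Proof.
move=> x; apply: cvgMr_tmp.
apply: (@continuous_comp _ _ _ (fun x : R => 4 - x ^+ 2) Num.sqrt).
  by apply: cvgB; [exact: cvg_cst|exact: exprn_continuous].
exact: sqrt_continuous.
Qed.

Lemma measurable_semicircle_pdf : measurable_fun setT semicircle_pdf.
Proof. apply: continuous_measurable_fun; exact: continuous_semicircle_pdf. Qed.

Let semicircle0 : semicircle set0 = 0%E.
Proof. by rewrite /semicircle integral_set0. Qed.

Let semicircle_ge0 A : (0 <= semicircle A)%E.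
Proof. by apply: integral_ge0 => x _; rewrite lee_fin semicircle_pdf_ge0. Qed.

Let semicircle_sigma_additive : semi_sigma_additive semicircle.
Proof.
move=> /= F mF tF mUF; rewrite /semicircle; apply: cvg_toP.
  apply: ereal_nondecreasing_is_cvgn => m n mn.
  apply: lee_sum_nneg_natr => // k _ _.
  by apply: integral_ge0 => /= x Fkx; rewrite lee_fin semicircle_pdf_ge0.
rewrite ge0_integral_bigcup//=.
- apply: measurable_funTS; apply: measurableT_comp => //.
  exact: measurable_semicircle_pdf.
- by move=> x _; rewrite lee_fin semicircle_pdf_ge0.
Qed.

HB.instance Definition _ := isMeasure.Build _ _ _ semicircle
  semicircle0 semicircle_ge0 semicircle_sigma_additive.

Let dsin2 : (fun u : R => 2 * sin u)^`()%classic = (fun u => 2 * cos u).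
Proof.
apply/funext => u; rewrite derive1E; exact: derive_val.
Qed.

Let dprim (u : R) :
  is_derive u (1 : R) (fun u : R => (u + sin u * cos u) / pi)
    (2 * cos u ^+ 2 / pi).
Proof.
apply: is_derive_eq; rewrite /GRing.scale/= mulr0 add0r.
have -> : sin u * - sin u = cos u ^+ 2 - 1 by rewrite cos2sin2; ring.
by ring.
Qed.

Let semicircleT : semicircle [set: _] = 1%E.
Proof.
rewrite /semicircle.
have piN0 : pi != 0 :> R by rewrite gt_eqF ?pi_gt0.
have pi0 := @pi_gt0 R.
transitivity (\int[leb]_(x in `[(- 2)%R, 2%R]) (semicircle_pdf x)%:E)%E.
  rewrite [RHS]integral_mkcond; apply: eq_integral => x _.
  rewrite patchE; case: ifPn => //; rewrite notin_setE/= in_itv/= => /negP xn.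
  rewrite /semicircle_pdf ler0_sqrtr ?mul0r// leNgt; apply: contra xn => x4.
  by apply/andP; split; nra.
pose F (u : R) : R := 2 * sin u.
have Fl : F (- (pi / 2)) = - 2 by rewrite /F sinN sin_pihalf mulrN1.
have Fr : F (pi / 2) = 2 by rewrite /F sin_pihalf mulr1.
have cF : continuous F by move=> u; apply: cvgMl_tmp; exact: continuous_sin.
have cF' : continuous F^`()%classic.
  by rewrite dsin2 => u; apply: cvgMl_tmp; exact: continuous_cos.
have ab : - (pi / 2) < pi / 2 :> R by lra.
rewrite -[in X in integral _ X _]Fl -[X in `[_, X]]Fr.
rewrite integration_by_substitution_increasing//; first last.
- by apply: continuous_subspaceT; exact: continuous_semicircle_pdf.
- split.
  + move=> u _; apply: ex_derive.
  + by apply: cvg_at_right_filter; exact: cF.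
  + by apply: cvg_at_left_filter; exact: cF.
- by apply/cvg_ex; eexists; apply: cvg_at_left_filter; exact: cF'.
- by apply/cvg_ex; eexists; apply: cvg_at_right_filter; exact: cF'.
- by move=> x y xi yi xy; rewrite ltr_pM2l// ltr_sin.
- exact: ltW.
transitivity (\int[leb]_(u in `[(- (pi / 2))%R, (pi / 2)%R])
    (2 * cos u ^+ 2 / pi)%:E)%E.
  apply: eq_integral => u; rewrite inE/= in_itv/= => ui.
  congr EFin; rewrite !fctE dsin2 /F /semicircle_pdf exprMn.
  have cu := cos_ge0_pihalf ui.
  have -> : 4 - 2 ^+ 2 * sin u ^+ 2 = (2 * cos u) ^+ 2.
    by rewrite exprMn cos2sin2; ring.
  rewrite sqrtr_sqr ger0_norm ?mulr_ge0//.
  by move: (@pi R) piN0 => p p0; field.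
rewrite (@continuous_FTC2 _ _ (fun u : R => (u + sin u * cos u) / pi))//.
- rewrite cosN cos_pihalf !mulr0 !addr0 -EFinB; congr EFin.
  by move: (@pi R) piN0 => p p0; field.
- apply: continuous_subspaceT => u; apply: cvgMr_tmp; apply: cvgMl_tmp.
  apply: (@continuous_comp _ _ _ cos (fun x : R => x ^+ 2)).
    exact: continuous_cos.
  exact: exprn_continuous.
- have cP : continuous (fun u : R => (u + sin u * cos u) / pi).
    by move=> u; apply/differentiable_continuous/derivable1_diffP; exact: ex_derive.
  split.
  + by move=> u _; exact: ex_derive.
  + by apply: cvg_at_right_filter; exact: cP.
  + by apply: cvg_at_left_filter; exact: cP.
- by move=> u _; rewrite derive1E; exact: derive_val.
Qed.

HB.instance Definition _ :=
  @Measure_isProbability.Build _ _ R semicircle semicircleT.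

End semicircle_law.

Section pseudometric.
Context {R : realType}.

(* The two probabilities are finite, so [fine] is harmless; for 0 < eps < 1 the
   set is nonempty and bounded by 1, so [sup] is its least upper bound. *)
Definition Delta (eps : R) (nu1 nu2 : probR R) : R :=
  sup [set `| fine (nu1 `]- 2 + eps, x]%classic) - fine (nu2 `]- 2 + eps, x]%classic) |
      | x in `[- 2 + eps, 2 - eps]%classic].

End pseudometric.

Section moments_and_dilations.
Context {R : realType}.

Definition abs_moment (mu : probR R) (k : nat) : \bar R :=
  (\int[mu]_x (`|x| ^+ k)%:E)%E.

Definition dilation (c : R) : measurableTypeR R -> measurableTypeR R :=
  fun x => c * x.

Let measurable_dilation c : measurable_fun setT (dilation c).
Proof. apply: continuous_measurable_fun; exact: mulrl_continuous. Qed.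

HB.instance Definition _ c :=
  isMeasurableFun.Build _ _ _ _ (dilation c) (measurable_dilation c).

Definition dilate (c : R) (mu : probR R) : probR R :=
  distribution mu (dilation c).

End moments_and_dilations.

Section free_additive_convolution.
Context {R : realType}.
Local Notation C := R[i].

Definition upper_half_plane : set C := [set z | 0 < complex.Im z].

(* [C^o] carries the normed module structure of [C] over itself, so that
   [derivable] at direction 1 is complex differentiability. *)
Definition holomorphic_on (U : set C) (f : C -> C) : Prop :=
  forall z, U z -> derivable (f : C^o -> C^o) z 1.

Definition cauchy_transform (nu : probR R) (z : C) : C :=
  Complex (\int[nu]_t complex.Re (z - t%:C%C)^-1)
          (\int[nu]_t complex.Im (z - t%:C%C)^-1).

Definition F_transform (nu : probR R) (z : C) : C := (cauchy_transform nu z)^-1.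

(* [nu] is the free additive convolution of the [n] measures [nu_ i], i.e. the
   law of a sum of free self-adjoint random variables with laws [nu_ i]; a
   probability measure is determined by its [F_transform] on the upper
   half-plane. *)
Definition is_free_convolution (n : nat) (nu_ : 'I_n -> probR R)
    (nu : probR R) : Prop :=
  exists Z : 'I_n -> C -> C,
    [/\ forall i, {homo Z i : z / upper_half_plane z},
        forall i, holomorphic_on upper_half_plane (Z i),
        forall z, upper_half_plane z ->
          \sum_(i < n) Z i z - z = (n%:R - 1) * F_transform nu z &
        forall z, upper_half_plane z ->
          forall i, F_transform nu z = F_transform (nu_ i) (Z i z)].

End free_additive_convolution.

Section sphere.
Context {R : realType}.

(* The sigma-algebra of [n.-tuple (measurableTypeR R)] is the product one, i.e.
   the Borel sigma-algebra of R^n. *)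
Local Notation Rn n := (n.-tuple (measurableTypeR R)).

Definition unit_sphere n : set (Rn n) :=
  [set x | \sum_(i < n) tnth x i ^+ 2 = 1].

Definition mxact n (Q : 'M[R]_n) (x : Rn n) : Rn n :=
  [tuple \sum_(j < n) Q i j * tnth x j | i < n].

(* The uniform distribution on the unit sphere of R^n is the unique Borel
   probability measure carried by the sphere and invariant under the orthogonal
   group O(n). *)
Definition uniform_on_sphere n (sigma : probability (Rn n) R) : Prop :=
  sigma (@unit_sphere n) = 1%E /\
  forall Q : 'M[R]_n, Q *m Q^T = 1%:M ->
  forall A : set (Rn n), measurable A -> sigma (mxact Q @^-1` A) = sigma A.

End sphere.

Arguments unit_sphere R n : clear implicits.

(* Main.v *)
Require Import Defs.
From HB Require Import structures.
From mathcomp Require Import all_boot all_order all_algebra.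
From mathcomp Require Import complex.
From mathcomp Require Import all_classical all_reals all_analysis.
From mathcomp Require Import measurable_realfun.
From mathcomp Require Import ring lra.
Import Order.TTheory GRing.Theory Num.Theory.
Import numFieldNormedType.Exports.
Local Open Scope classical_set_scope.
Local Open Scope ring_scope.

(** Let [G] be the Cauchy transform of the free convolution [mu_theta] and [Z_i]
    the subordination functions, so that [G z = G_i (Z_i z)] with [G_i] the
    Cauchy transform of the law of [theta_i X_i]. Since [X_i] has mean zero and
    variance one, expanding [G_i] at infinity gives
      [Z_i G - 1 = theta_i^2 G^2 + m_3 theta_i^3 G^3 + O(theta_i^4)]
    as long as [Im Z_i] is bounded below ([summand_expansion]). The relation
    [\sum Z_i - z = (n - 1) / G] says that the left-hand sides add up to
    [z G - 1], and [\sum theta_i^2 = 1], so [G] almost solves the equation of the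
    semicircle law ([approx_quadratic]):
      [G^2 - z G + 1 = O(|\sum theta_i^3| + \sum theta_i^4)].

    The right-hand side is [O(1 / n)] for typical weights. Under the uniform
    distribution of the sphere [\sum theta_i^4] has mean [3 / (n + 2)], and the
    cubes [theta_i^3] are uncorrelated by symmetry, so that [\sum theta_i^3] has
    variance [15 / ((n + 2) (n + 4))]. Both values follow from the invariance
    under two kinds of reflections ([sphere_fourth_moment],
    [sphere_sixth_moment], [sphere_cubes]), and the inequality of Markov provides
    the set of typical weights ([sphere_typical]).

    What makes the estimate uniform down to the real axis is that
    [|Re z| <= 2 - eps] is the interior of the limiting spectrum. There every
    approximate solution of the quadratic equation in the lower half-plane has
    [Im (1 / G) >= eps / 8] ([quadratic_root_away]), while [Z_i] is within
    [O(theta_i^2)] of [1 / G]; hence [Im Z_i] cannot take the value [eps / 16]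
    ([subordination_gap]). As [Im Z_i >= Im z], it exceeds this value at height
    1, and by continuity it does so on the whole vertical segment below. Finally
    the two roots of the exact equation on the axis are [sqrt (4 - x^2)] apart,
    so that [- Im G] is within [O(1 / n)] of [sqrt (4 - x^2) / 2], which is [pi]
    times the semicircle density ([cauchy_transform_interior]). Integrating this
    by Stieltjes inversion ([stieltjes_density_bound]) bounds the difference of
    the distribution functions. *)

Set Implicit Arguments.
Unset Strict Implicit.
Unset Printing Implicit Defensive.

(** * Arithmetic of complex numbers *)

Section complex_norm.
Context {R : realType}.
Local Notation C := R[i].
Implicit Types x y z : C.

Lemma normc_ge0 z : 0 <= Normc.normc z.
Proof. by case: z => a b; exact: sqrtr_ge0. Qed.

Lemma normc_sqr z : Normc.normc z ^+ 2 = complex.Re z ^+ 2 + complex.Im z ^+ 2.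
Proof. by case: z => a b /=; rewrite sqr_sqrtr// addr_ge0 ?sqr_ge0. Qed.

Lemma normcD x y : Normc.normc (x + y) <= Normc.normc x + Normc.normc y.
Proof. exact: le_normcD. Qed.

Lemma normc_opp z : Normc.normc (- z) = Normc.normc z.
Proof. by case: z => a b /=; rewrite !sqrrN. Qed.

Lemma normcB x y : Normc.normc (x - y) <= Normc.normc x + Normc.normc y.
Proof. by rewrite -(normc_opp y); exact: normcD. Qed.

Lemma normcX z n : Normc.normc (z ^+ n) = Normc.normc z ^+ n.
Proof.
elim: n => [|n IH]; first by rewrite !expr0; exact: Normc.normc1.
by rewrite !exprS Normc.normcM IH.
Qed.

Lemma normc_sum n (F : 'I_n -> C) :
  Normc.normc (\sum_(i < n) F i) <= \sum_(i < n) Normc.normc (F i).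
Proof.
elim/big_ind2 : _ => //; first by rewrite Normc.normc0.
by move=> a b c d ab cd; apply: (le_trans (normcD _ _)); exact: lerD.
Qed.

Lemma normc_Re z : `|complex.Re z| <= Normc.normc z.
Proof.
rewrite -(ler_pXn2r (_ : 0 < 2)%N) ?nnegrE ?normc_ge0//.
by rewrite normc_sqr real_normK ?num_real// lerDl sqr_ge0.
Qed.

Lemma normc_Im z : `|complex.Im z| <= Normc.normc z.
Proof.
rewrite -(ler_pXn2r (_ : 0 < 2)%N) ?nnegrE ?normc_ge0//.
by rewrite normc_sqr real_normK ?num_real// lerDr sqr_ge0.
Qed.

Lemma normc_real (a : R) : Normc.normc a%:C%C = `|a|.
Proof. by rewrite /= expr0n addr0 sqrtr_sqr. Qed.

Lemma normc_nat n : Normc.normc (n%:R : C) = n%:R.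
Proof.
have -> : n%:R = (n%:R)%:C%C :> C by rewrite rmorph_nat.
by rewrite normc_real ger0_norm.
Qed.

Lemma ReD x y : complex.Re (x + y) = complex.Re x + complex.Re y.
Proof. by case: x => a b; case: y. Qed.

Lemma ImD x y : complex.Im (x + y) = complex.Im x + complex.Im y.
Proof. by case: x => a b; case: y. Qed.

Lemma ReN z : complex.Re (- z) = - complex.Re z.
Proof. by case: z. Qed.

Lemma ImN z : complex.Im (- z) = - complex.Im z.
Proof. by case: z. Qed.

Lemma ReB x y : complex.Re (x - y) = complex.Re x - complex.Re y.
Proof. by case: x => a b; case: y. Qed.

Lemma ImB x y : complex.Im (x - y) = complex.Im x - complex.Im y.
Proof. by case: x => a b; case: y. Qed.

Lemma ReM x y :
  complex.Re (x * y) = complex.Re x * complex.Re y - complex.Im x * complex.Im y.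
Proof. by case: x => a b; case: y. Qed.

Lemma ImM x y :
  complex.Im (x * y) = complex.Re x * complex.Im y + complex.Im x * complex.Re y.
Proof. by case: x => a b; case: y. Qed.

Lemma ReV z : complex.Re z^-1 = complex.Re z / Normc.normc z ^+ 2.
Proof. by rewrite normc_sqr; case: z => a b. Qed.

Lemma ImV z : complex.Im z^-1 = - complex.Im z / Normc.normc z ^+ 2.
Proof. by rewrite normc_sqr; case: z => a b /=; rewrite mulNr. Qed.

Lemma Im_sum n (F : 'I_n -> C) :
  complex.Im (\sum_(i < n) F i) = \sum_(i < n) complex.Im (F i).
Proof. by elim/big_ind2 : _ => // a b c d <- <-; rewrite ImD. Qed.

Lemma Im_neq0 z : complex.Im z != 0 -> z != 0.
Proof. by apply: contra => /eqP ->. Qed.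

End complex_norm.

(** * Perturbations of the quadratic equation of the semicircle law *)

Section semicircle_quadratic.
Context {R : realType}.
Local Notation C := R[i].

(** With [F = G^-1] the equation reads [F + F^-1 = z + r F], a small real
    perturbation of the Joukowski equation; for [|Re z| < 2] its solutions
    stay away from the real axis, because [Re z = Re F (1 + |F|^-2)] and
    [|F| + |F|^-1 >= 2]. *)
Lemma quadratic_root_away (eps eta : R) (z G : C) :
  0 < eps < 1 -> eta <= eps / 24 ->
  `|complex.Re z| <= 2 - eps -> Normc.normc z <= 3 -> complex.Im G < 0 ->
  Normc.normc (G ^+ 2 - z * G + 1) <= eta ->
  [/\ Normc.normc G <= 4, Normc.normc G^-1 <= 6 & eps / 8 <= complex.Im G^-1].
Proof.
move=> /andP[eps0 eps1] eta_eps Rez nz ImG.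
set r := _ + 1 => nr.
have G0 : G != 0 by apply: Im_neq0; rewrite lt_eqF.
have nG0 : 0 < Normc.normc G.
  rewrite lt_def normc_ge0 andbT; apply: contra G0 => /eqP.
  by move=> /Normc.eq0_normc ->.
have nzG : Normc.normc (z * G) <= 3 * Normc.normc G.
  by rewrite Normc.normcM ler_wpM2r// ltW.
have n1 : Normc.normc (1 : C) = 1 by exact: Normc.normc1.
have nG4 : Normc.normc G <= 4.
  rewrite leNgt; apply/negP => G4.
  have : Normc.normc (G ^+ 2) <= eta + 3 * Normc.normc G + 1.
    have -> : G ^+ 2 = r + z * G - 1 by rewrite /r; ring.
    apply: (le_trans (normcB _ _)); rewrite n1 lerD2r.
    by apply: (le_trans (normcD _ _)); exact: lerD.
  by rewrite normcX; nra.
have nG6 : 6^-1 <= Normc.normc G.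
  rewrite leNgt; apply/negP => G6.
  have : 1 <= eta + 3 * Normc.normc G + Normc.normc G ^+ 2.
    rewrite -[leLHS]n1.
    have -> : 1 = r + z * G - G ^+ 2 :> C by rewrite /r; ring.
    apply: (le_trans (normcB _ _)); rewrite normcX lerD2r.
    by apply: (le_trans (normcD _ _)); exact: lerD.
  nra.
set F := G^-1.
have nF : Normc.normc F = (Normc.normc G)^-1 by exact: Normc.normcV.
have nF6 : Normc.normc F <= 6.
  by rewrite nF -[leRHS]invrK lef_pV2// posrE.
have nF4 : 4^-1 <= Normc.normc F by rewrite nF lef_pV2// posrE.
split => //.
have FG : F * G = 1 by rewrite mulVf.
have eqF : F + F^-1 = z + r * F.
  rewrite invrK /r.
  have -> : z + (G ^+ 2 - z * G + 1) * F = z + G * (F * G) - z * (F * G) + F.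
    by ring.
  by rewrite FG; ring.
(* With [eta <= eps / 24] and [|F| <= 6] the perturbation [r F] moves [Re z] by
   at most [eps / 4]. *)
set x' := complex.Re z + complex.Re (r * F).
have x'_le : `|x'| <= 2 - eps / 2.
  rewrite (le_trans (ler_normD _ _))//.
  have : `|complex.Re (r * F)| <= eta * 6.
    rewrite (le_trans (normc_Re _))// Normc.normcM.
    by apply: ler_pM => //; exact: normc_ge0.
  lra.
have : complex.Re F * (1 + (Normc.normc F ^+ 2)^-1) = x'.
  by rewrite /x' -ReD -eqF ReD (ReV F) mulrDr mulr1.
have ImF : 0 < complex.Im F.
  by rewrite /F ImV divr_gt0 ?oppr_gt0// exprn_gt0.
have : Normc.normc F ^+ 2 = complex.Re F ^+ 2 + complex.Im F ^+ 2.
  exact: normc_sqr.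
have s16 : 16^-1 <= Normc.normc F ^+ 2 by nra.
move: (Normc.normc F ^+ 2) s16 => s s16.
move: (complex.Re F) (complex.Im F) ImF => p q q0 spq px.
have s0 : 0 < s by lra.
have ps : p * (s + 1) = s * x'.
  by rewrite -px; field; rewrite gt_eqF.
have x2 : x' ^+ 2 <= (2 - eps / 2) ^+ 2.
  by rewrite -(real_normK (num_real x')); apply: lerXn2r; rewrite ?nnegrE//; lra.
(* [q^2 = s (1 - s x'^2 / (s + 1)^2) >= s (1 - x'^2 / 4)] as [4 s <= (s + 1)^2]. *)
have q2 : (eps / 8) ^+ 2 <= q ^+ 2.
  have -> : q ^+ 2 = s - p ^+ 2 by rewrite spq; ring.
  have pp : p ^+ 2 * (s + 1) ^+ 2 = s ^+ 2 * x' ^+ 2 by rewrite -!exprMn ps.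
  have p4 : 4 * p ^+ 2 <= s * x' ^+ 2.
    have h : 4 * p ^+ 2 * (s + 1) ^+ 2 <= s * x' ^+ 2 * (s + 1) ^+ 2.
      have -> : 4 * p ^+ 2 * (s + 1) ^+ 2 = s * x' ^+ 2 * (4 * s).
        by rewrite -mulrA pp; ring.
      apply: ler_wpM2l; first by rewrite mulr_ge0 ?sqr_ge0// ltW.
      have := sqr_ge0 (s - 1); nra.
    by move: h; rewrite ler_pM2r// exprn_gt0//; lra.
  have : s * x' ^+ 2 <= s * (2 - eps / 2) ^+ 2 by apply: ler_wpM2l; rewrite // ltW.
  have : 16^-1 * (eps / 2) <= s * (eps / 2) by apply: ler_wpM2r => //; lra.
  have : 0 <= s * (eps / 2 * (1 - eps / 2)) by rewrite mulr_ge0 ?mulr_ge0//; lra.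
  nra.
rewrite -(ler_pXn2r (_ : 0 < 2)%N)//; rewrite nnegrE; lra.
Qed.

(** At [z = x + i y] the exact equation [G^2 - x G + 1 = 0] has the conjugate
    roots [(x -+ i sqrt (4 - x^2)) / 2]. A solution in the lower half-plane is
    at distance at least [sqrt (4 - x^2) / 2] from the upper one, so a residual
    controls its distance to the lower one. *)
Lemma quadratic_root_near (eps eta x y : R) (G : C) :
  0 < eps < 1 -> 0 <= y -> `|x| <= 2 - eps ->
  Normc.normc G <= 4 -> complex.Im G < 0 ->
  Normc.normc (G ^+ 2 - Complex x y * G + 1) <= eta ->
  `| - complex.Im G - Num.sqrt (4 - x ^+ 2) / 2 | <= 2 * (eta + 4 * y) / eps.
Proof.
move=> /andP[eps0 eps1] y0 xle nG ImG.
set r := _ + 1 => nr.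
set s := Num.sqrt (4 - x ^+ 2).
have x2 : x ^+ 2 <= (2 - eps) ^+ 2.
  by rewrite -(real_normK (num_real x)); apply: lerXn2r; rewrite ?nnegrE//; lra.
have s2 : s ^+ 2 = 4 - x ^+ 2 by rewrite sqr_sqrtr//; nra.
have s0 : 0 <= s by exact: sqrtr_ge0.
have seps : eps <= s.
  by rewrite -(ler_pXn2r (_ : 0 < 2)%N) ?nnegrE// ?s2; nra.
pose g1 : C := Complex (x / 2) (- (s / 2)).
pose g2 : C := Complex (x / 2) (s / 2).
have fact : (G - g1) * (G - g2) = r + Complex 0 y * G.
  apply/eqP; rewrite eq_complex /r /g1 /g2 !expr2.
  rewrite !(ReD, ImD, ReN, ImN, ReM, ImM) /=.
  move: s2; rewrite !expr2 => s2.
  by apply/andP; split; apply/eqP; lra.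
have nfact : Normc.normc (G - g1) * Normc.normc (G - g2) <= eta + 4 * y.
  rewrite -Normc.normcM fact (le_trans (normcD _ _))// lerD// Normc.normcM.
  have -> : Normc.normc (Complex 0 y) = y.
    by rewrite /= expr0n add0r sqrtr_sqr ger0_norm.
  by rewrite mulrC ler_wpM2r.
have g2l : eps / 2 <= Normc.normc (G - g2).
  apply: le_trans (normc_Im _); rewrite ImB /= ler0_norm; lra.
have g1l : `| - complex.Im G - s / 2| <= Normc.normc (G - g1).
  apply: le_trans (normc_Im _); rewrite ImB /= -normrN opprD !opprK.
  by rewrite addrC.
rewrite (le_trans g1l)// ler_pdivlMr//.
have := normc_ge0 (G - g1); nra.
Qed.

End semicircle_quadratic.

(** * Integrals of complex-valued functions and the Cauchy kernel *)

Section real_integrals.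
Context d {T : measurableType d} {R : realType} (P : probability T R).
Implicit Types f g : T -> R.

Definition rintegrable f := P.-integrable [set: T] (EFin \o f).

Lemma rintegrable_measurable f : rintegrable f -> measurable_fun setT f.
Proof. by move=> /integrableP[mf _]; apply/measurable_EFinP. Qed.

Lemma rintegrable_cst (a : R) : rintegrable (fun=> a).
Proof. exact: finite_measure_integrable_cst. Qed.

Lemma rintegrableD f g : rintegrable f -> rintegrable g ->
  rintegrable (fun x => f x + g x).
Proof. by move=> f_i g_i; exact: (integrableD measurableT f_i g_i). Qed.

Lemma rintegrableB f g : rintegrable f -> rintegrable g ->
  rintegrable (fun x => f x - g x).
Proof. by move=> f_i g_i; exact: (integrableB measurableT f_i g_i). Qed.

Lemma rintegrableZ a f : rintegrable f -> rintegrable (fun x => a * f x).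
Proof. by move=> f_i; exact: (integrableZl measurableT a f_i). Qed.

Lemma rintegrable_le f g : measurable_fun setT f ->
  (forall x, `|f x| <= g x) -> rintegrable g -> rintegrable f.
Proof.
move=> mf fg; apply: le_integrable => //; first exact/measurable_EFinP.
by move=> x _; rewrite /= lee_fin (le_trans (fg x))// ler_norm.
Qed.

Lemma rintegrable_norm f : rintegrable f -> rintegrable (fun x => `|f x|).
Proof. exact: integrable_norm. Qed.

Lemma rintegral_cst (a : R) : \int[P]_x a = a.
Proof.
by rewrite Rintegral_cst//= [X in fine X](@probability_setT _ _ _ P) mulr1.
Qed.

Lemma rintegralD f g : rintegrable f -> rintegrable g ->
  \int[P]_x (f x + g x) = \int[P]_x f x + \int[P]_x g x.
Proof. by move=> ? ?; rewrite RintegralD. Qed.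

Lemma rintegralB f g : rintegrable f -> rintegrable g ->
  \int[P]_x (f x - g x) = \int[P]_x f x - \int[P]_x g x.
Proof. by move=> ? ?; rewrite RintegralB. Qed.

Lemma rintegralZ a f : rintegrable f ->
  \int[P]_x (a * f x) = a * \int[P]_x f x.
Proof. by move=> ?; rewrite RintegralZl. Qed.

Lemma rintegral_le f g : rintegrable f -> rintegrable g ->
  (forall x, f x <= g x) -> \int[P]_x f x <= \int[P]_x g x.
Proof. by move=> ? ? fg; rewrite le_Rintegral. Qed.

Lemma rintegral_gt0 f : rintegrable f -> (forall x, 0 < f x) ->
  0 < \int[P]_x f x.
Proof.
move=> f_i f0; rewrite lt_neqAle Rintegral_ge0 ?andbT; last first.
  by move=> x _; exact: ltW.
apply/eqP => int0.
have /(ae_eq_integral_abs P measurableT) : measurable_fun setT (EFin \o f).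
  by case/integrableP: f_i.
case=> + _; have -> : (\int[P]_x `|(EFin \o f) x| = 0)%E.
  under eq_integral do rewrite /= ger0_norm ?(ltW (f0 _))//.
  have fin := integrable_fin_num measurableT f_i.
  by rewrite -(fineK fin); move: int0; rewrite /Rintegral => <-.
move=> /(_ erefl) [N [mN N0 fN]].
have : (P setT <= P N)%E.
  by apply: le_measure; rewrite ?inE// => x _; apply: fN => /= /(_ I) [] fx0;
     move: (f0 x); rewrite fx0 ltxx.
by rewrite N0 probability_setT leNgt lte_fin ltr01.
Qed.

End real_integrals.

Section complex_integrals.
Context d {T : measurableType d} {R : realType} (P : probability T R).
Local Notation C := R[i].
Implicit Types f g : T -> C.

Definition cintegrable f :=
  rintegrable P (fun t => complex.Re (f t)) /\
  rintegrable P (fun t => complex.Im (f t)).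

Definition cintegral f : C :=
  Complex (\int[P]_t complex.Re (f t)) (\int[P]_t complex.Im (f t)).

Lemma eq_cintegral f g : f =1 g -> cintegral f = cintegral g.
Proof. by move=> /funext ->. Qed.

Lemma cintegrable_real (f : T -> R) :
  rintegrable P f -> cintegrable (fun t => (f t)%:C%C).
Proof. by move=> f_i; split => //=; exact: rintegrable_cst. Qed.

Lemma cintegral_real (f : T -> R) :
  cintegral (fun t => (f t)%:C%C) = (\int[P]_t f t)%:C%C.
Proof. by rewrite /cintegral/= rintegral_cst. Qed.

Lemma cintegralD f g : cintegrable f -> cintegrable g ->
  cintegral (fun t => f t + g t) = cintegral f + cintegral g.
Proof.
move=> [fr fi] [gr gi]; rewrite /cintegral.
under eq_Rintegral do rewrite ReD.
under [X in Complex _ X]eq_Rintegral do rewrite ImD.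
by rewrite !rintegralD.
Qed.

Lemma cintegrableZ a f : cintegrable f -> cintegrable (fun t => a * f t).
Proof.
move=> [fr fi]; split.
  by under eq_fun do rewrite ReM; apply: rintegrableB; exact: rintegrableZ.
by under eq_fun do rewrite ImM; apply: rintegrableD; exact: rintegrableZ.
Qed.

Lemma cintegralZ a f : cintegrable f ->
  cintegral (fun t => a * f t) = a * cintegral f.
Proof.
move=> [fr fi]; rewrite /cintegral.
under eq_Rintegral do rewrite ReM.
under [X in Complex _ X]eq_Rintegral do rewrite ImM.
rewrite rintegralB ?rintegralD; try exact: rintegrableZ.
by rewrite !rintegralZ//; case: a.
Qed.

(** Rotating the integral onto the positive real axis reduces the triangle
    inequality to the real one. *)
Lemma normc_cintegral f (g : T -> R) : cintegrable f -> rintegrable P g ->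
  (forall t, Normc.normc (f t) <= g t) ->
  Normc.normc (cintegral f) <= \int[P]_t g t.
Proof.
move=> f_i g_i fg; set J := cintegral f.
have [J0|J0] := eqVneq J 0.
  rewrite J0 Normc.normc0; apply: Rintegral_ge0 => t _.
  exact: le_trans (normc_ge0 _) (fg t).
have nJ0 : Normc.normc J != 0.
  by apply: contra J0 => /eqP/Normc.eq0_normc ->.
set u : C := (Normc.normc J)%:C%C / J.
have nu : Normc.normc u = 1.
  by rewrite Normc.normcM Normc.normcV normc_real ger0_norm ?normc_ge0// divff.
have -> : Normc.normc J = \int[P]_t complex.Re (u * f t).
  transitivity (complex.Re (cintegral (fun t => u * f t))) => //.
  by rewrite cintegralZ// /u mulfVK.
apply: rintegral_le => //; first by case: (cintegrableZ u f_i).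
move=> t; apply: (le_trans (ler_norm _)); apply: (le_trans (normc_Re _)).
by rewrite Normc.normcM nu mul1r.
Qed.

Lemma cintegrable_le f (g : T -> R) :
  measurable_fun setT (fun t => complex.Re (f t)) ->
  measurable_fun setT (fun t => complex.Im (f t)) ->
  rintegrable P g -> (forall t, Normc.normc (f t) <= g t) -> cintegrable f.
Proof.
move=> mr mi g_i fg; split; apply: rintegrable_le g_i => // t.
  exact: le_trans (normc_Re _) (fg t).
exact: le_trans (normc_Im _) (fg t).
Qed.

End complex_integrals.

Section cauchy_kernel.
Context {R : realType}.
Local Notation C := R[i].
Implicit Types (w : C) (t : R).

Lemma Im_subr_real w t : complex.Im (w - t%:C%C) = complex.Im w.
Proof. by rewrite ImB subr0. Qed.

Lemma subr_real_neq0 w t : 0 < complex.Im w -> w - t%:C%C != 0.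
Proof. by move=> w0; rewrite Im_neq0// Im_subr_real gt_eqF. Qed.

Lemma normc_sub_real_gt0 w t : 0 < complex.Im w -> 0 < Normc.normc (w - t%:C%C).
Proof.
move=> w0; rewrite lt_def normc_ge0 andbT.
by apply: contra (subr_real_neq0 t w0) => /eqP/Normc.eq0_normc ->.
Qed.

Lemma normc_cauchy_kernel w t c : 0 < c -> c <= complex.Im w ->
  Normc.normc (w - t%:C%C)^-1 <= c^-1.
Proof.
move=> c0 cw; have w0 : 0 < complex.Im w by exact: lt_le_trans cw.
rewrite Normc.normcV lef_pV2 ?posrE ?normc_sub_real_gt0//.
by rewrite (le_trans cw)// -(Im_subr_real w t) (le_trans (ler_norm _))// normc_Im.
Qed.

Lemma Re_cauchy_kernel w t : complex.Re (w - t%:C%C)^-1 =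
  (complex.Re w - t) * ((complex.Re w - t) ^+ 2 + complex.Im w ^+ 2)^-1.
Proof. by rewrite ReV normc_sqr ReB Im_subr_real. Qed.

Lemma Im_cauchy_kernel w t : complex.Im (w - t%:C%C)^-1 =
  - complex.Im w * ((complex.Re w - t) ^+ 2 + complex.Im w ^+ 2)^-1.
Proof. by rewrite ImV normc_sqr ReB Im_subr_real. Qed.

Lemma kernel_denom_gt0 w t : 0 < complex.Im w ->
  0 < (complex.Re w - t) ^+ 2 + complex.Im w ^+ 2.
Proof. by move=> w0; rewrite ltr_wpDl ?sqr_ge0// exprn_gt0. Qed.

Lemma measurable_kernel_denom w : 0 < complex.Im w ->
  measurable_fun setT
    (fun t => ((complex.Re w - t) ^+ 2 + complex.Im w ^+ 2)^-1).
Proof.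
move=> w0; apply: continuous_measurable_fun => t.
apply: cvgV; first by rewrite gt_eqF// kernel_denom_gt0.
apply: cvgD; last exact: cvg_cst.
apply: (@continuous_comp _ _ _ (fun t : R => complex.Re w - t) (fun x => x ^+ 2)).
  by apply: cvgB; [exact: cvg_cst|exact: cvg_id].
exact: exprn_continuous.
Qed.

Lemma measurable_Re_cauchy_kernel w : 0 < complex.Im w ->
  measurable_fun setT (fun t : R => complex.Re (w - t%:C%C)^-1).
Proof.
move=> w0; under eq_fun do rewrite Re_cauchy_kernel.
apply: measurable_funM; last exact: measurable_kernel_denom.
by apply: measurable_funB.
Qed.

Lemma measurable_Im_cauchy_kernel w : 0 < complex.Im w ->
  measurable_fun setT (fun t : R => complex.Im (w - t%:C%C)^-1).
Proof.
move=> w0; under eq_fun do rewrite Im_cauchy_kernel.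
by apply: measurable_funM => //; exact: measurable_kernel_denom.
Qed.

End cauchy_kernel.

(** * Cauchy transforms and their expansion at infinity *)

Section cauchy_transform_bounds.
Context {R : realType}.
Local Notation C := R[i].
Variable nu : probR R.
Implicit Types w : C.

Lemma cauchy_transformE w :
  cauchy_transform nu w = cintegral nu (fun t => (w - t%:C%C)^-1).
Proof. by []. Qed.

Lemma cintegrable_cauchy_kernel w : 0 < complex.Im w ->
  cintegrable nu (fun t => (w - t%:C%C)^-1).
Proof.
move=> w0; apply: (cintegrable_le (g := fun=> (complex.Im w)^-1)).
- exact: measurable_Re_cauchy_kernel.
- exact: measurable_Im_cauchy_kernel.
- exact: rintegrable_cst.
- by move=> t; exact: normc_cauchy_kernel.
Qed.

Lemma Im_cauchy_transform_lt0 w : 0 < complex.Im w ->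
  complex.Im (cauchy_transform nu w) < 0.
Proof.
move=> w0; rewrite -oppr_gt0 -mulN1r -rintegralZ; last first.
  by case: (cintegrable_cauchy_kernel w0).
apply: rintegral_gt0.
  by apply: rintegrableZ; case: (cintegrable_cauchy_kernel w0).
move=> t; rewrite Im_cauchy_kernel mulrA mulN1r opprK mulr_gt0//.
by rewrite invr_gt0 kernel_denom_gt0.
Qed.

Lemma cauchy_transform_neq0 w : 0 < complex.Im w -> cauchy_transform nu w != 0.
Proof. by move=> /Im_cauchy_transform_lt0 h; rewrite Im_neq0// lt_eqF. Qed.

(** The variance of the Cauchy kernel [r = (w - t)^-1] is nonnegative and
    [|r|^2 = - Im r / Im w]. *)
Lemma cauchy_transform_variance w : 0 < complex.Im w ->
  complex.Im w * Normc.normc (cauchy_transform nu w) ^+ 2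
  <= - complex.Im (cauchy_transform nu w).
Proof.
move=> w0; have [ir ii] := cintegrable_cauchy_kernel w0.
rewrite normc_sqr cauchy_transformE /=.
set a := \int[nu]_t _; set b := \int[nu]_t _.
pose k := (complex.Im w)^-1.
have : 0 <= \int[nu]_t ((- k - 2 * b) * complex.Im (w - t%:C%C)^-1 +
    ((- (2 * a)) * complex.Re (w - t%:C%C)^-1 + (a ^+ 2 + b ^+ 2))).
  apply: Rintegral_ge0 => t _.
  set X := complex.Re _; set Y := complex.Im (w - t%:C%C)^-1.
  suff -> : (- k - 2 * b) * Y + (- (2 * a) * X + (a ^+ 2 + b ^+ 2)) =
      (X - a) ^+ 2 + (Y - b) ^+ 2 by rewrite addr_ge0// sqr_ge0.
  have kY : - k * Y = X ^+ 2 + Y ^+ 2.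
    rewrite /X /Y /k Re_cauchy_kernel Im_cauchy_kernel.
    by field; rewrite !gt_eqF// kernel_denom_gt0.
  by rewrite mulrBl kY; ring.
rewrite rintegralD; first last.
- by apply: rintegrableD; [exact: rintegrableZ|exact: rintegrable_cst].
- exact: rintegrableZ.
rewrite rintegralD; [|exact: rintegrableZ|exact: rintegrable_cst].
rewrite !rintegralZ// rintegral_cst -/a -/b => h.
have h2 : a ^+ 2 + b ^+ 2 <= - b / complex.Im w by rewrite -/k; lra.
by rewrite mulrC -ler_pdivlMr.
Qed.

Lemma Im_F_transform w : 0 < complex.Im w ->
  complex.Im w <= complex.Im (F_transform nu w).
Proof.
move=> w0; rewrite /F_transform ImV ler_pdivlMr ?cauchy_transform_variance//.
rewrite exprn_gt0// lt_def normc_ge0 andbT.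
by apply: contra (cauchy_transform_neq0 w0) => /eqP/Normc.eq0_normc ->.
Qed.

Lemma normc_cauchy_transform w c : 0 < c -> c <= complex.Im w ->
  Normc.normc (cauchy_transform nu w) <= c^-1.
Proof.
move=> c0 cw; rewrite -(rintegral_cst nu (c^-1)).
apply: normc_cintegral => [||t]; first exact/cintegrable_cauchy_kernel/(lt_le_trans c0).
  exact: rintegrable_cst.
exact: normc_cauchy_kernel.
Qed.

End cauchy_transform_bounds.

Section cauchy_transform_expansion.
Context {R : realType}.
Local Notation C := R[i].
Variable mu : probR R.
Implicit Types (w : C) (theta : R).

(** These are the remainders of the Laurent expansion at infinity of the Cauchy
    transform of the law of [theta X]. *)
Definition weighted_cauchy (k : nat) theta w : C :=
  cintegral mu (fun t => (t ^+ k)%:C%C * (w - (theta * t)%:C%C)^-1).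

Lemma measurable_cauchy_kernel_scale theta w : 0 < complex.Im w ->
  measurable_fun setT (fun t : R => complex.Re (w - (theta * t)%:C%C)^-1) /\
  measurable_fun setT (fun t : R => complex.Im (w - (theta * t)%:C%C)^-1).
Proof.
move=> w0; have mt : measurable_fun setT (fun t : R => theta * t).
  by apply: measurable_funM.
split.
  exact: (measurableT_comp (measurable_Re_cauchy_kernel w0) mt).
exact: (measurableT_comp (measurable_Im_cauchy_kernel w0) mt).
Qed.

Lemma normc_weighted_kernel k theta w t c : 0 < c -> c <= complex.Im w ->
  Normc.normc ((t ^+ k)%:C%C * (w - (theta * t)%:C%C)^-1) <= c^-1 * `|t ^+ k|.
Proof.
move=> c0 cw; rewrite Normc.normcM normc_real mulrC ler_wpM2r//.
exact: normc_cauchy_kernel.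
Qed.

Lemma cintegrable_weighted k theta w : 0 < complex.Im w ->
  rintegrable mu (fun t => t ^+ k) ->
  cintegrable mu (fun t => (t ^+ k)%:C%C * (w - (theta * t)%:C%C)^-1).
Proof.
move=> w0 ik; have [mr mi] := measurable_cauchy_kernel_scale theta w0.
pose g (t : measurableTypeR R) : R := (complex.Im w)^-1 * `|(t : R) ^+ k|.
apply: (cintegrable_le (g := g)).
- under eq_fun do rewrite ReM mul0r subr0.
  by apply: measurable_funM => //; exact: exprn_measurable.
- under eq_fun do rewrite ImM mul0r addr0.
  by apply: measurable_funM => //; exact: exprn_measurable.
- by apply: rintegrableZ; exact: rintegrable_norm.
- by move=> t; exact: normc_weighted_kernel.
Qed.

Lemma normc_weighted_cauchy k theta w c : 0 < c -> c <= complex.Im w ->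
  rintegrable mu (fun t => t ^+ k) ->
  Normc.normc (weighted_cauchy k theta w) <= (\int[mu]_t `|t ^+ k|) / c.
Proof.
move=> c0 cw ik; rewrite mulrC -rintegralZ; last exact: rintegrable_norm.
apply: normc_cintegral.
- by apply: cintegrable_weighted => //; exact: lt_le_trans cw.
- by apply: rintegrableZ; exact: rintegrable_norm.
- by move=> t; exact: normc_weighted_kernel.
Qed.

(** This integrates [w / (w - s) = 1 + s / (w - s)] at [s = theta t]; iterating
    it produces the Laurent expansion with an exact remainder. *)
Lemma weighted_cauchy_rec k theta w : 0 < complex.Im w ->
  rintegrable mu (fun t => t ^+ k) -> rintegrable mu (fun t => t ^+ k.+1) ->
  w * weighted_cauchy k theta w =
    (\int[mu]_t (t ^+ k))%:C%C + theta%:C%C * weighted_cauchy k.+1 theta w.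
Proof.
move=> w0 ik ik1; rewrite -cintegral_real -!cintegralZ; try exact: cintegrable_weighted.
rewrite -cintegralD; first last.
- by apply: cintegrableZ; exact: cintegrable_weighted.
- exact: cintegrable_real.
apply: eq_cintegral => t; rewrite exprS.
have := subr_real_neq0 (theta * t) w0.
rewrite !rmorphM/=; set T := t%:C%C; set th := theta%:C%C.
set Tk := (t ^+ k)%:C%C => h.
by field.
Qed.

Lemma cauchy_transform_dilate theta w : 0 < complex.Im w ->
  cauchy_transform (dilate theta mu) w = weighted_cauchy 0 theta w.
Proof.
move=> w0; have i0 : rintegrable mu (fun t => t ^+ 0) by exact: rintegrable_cst.
have [ir ii] : cintegrable mu (fun t => (w - (theta * t)%:C%C)^-1).
  have := cintegrable_weighted theta w0 i0; congr cintegrable.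
  by apply/funext => t; rewrite expr0 mul1r.
transitivity (cintegral mu (fun t => (w - (theta * t)%:C%C)^-1)); last first.
  by apply: eq_cintegral => t; rewrite expr0 mul1r.
congr Complex; rewrite /Rintegral; congr fine.
  rewrite /dilate integral_distribution//.
  by apply/measurable_EFinP; exact: measurable_Re_cauchy_kernel.
rewrite /dilate integral_distribution//.
by apply/measurable_EFinP; exact: measurable_Im_cauchy_kernel.
Qed.

End cauchy_transform_expansion.

(** * The approximate quadratic equation *)

Section quadratic_equation.
Context {R : realType}.
Local Notation C := R[i].
Variables (mu : probR R) (b3 b4 : R).

Definition standardized := [/\
  forall k, (k <= 4)%N -> rintegrable mu (fun t => t ^+ k),
  \int[mu]_t (t ^+ 1) = 0, \int[mu]_t (t ^+ 2) = 1,
  \int[mu]_t `|t ^+ 3| <= b3 & \int[mu]_t `|t ^+ 4| <= b4].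

Hypothesis mu_std : standardized.

Lemma standardized_ge0 : 0 <= b3 /\ 0 <= b4.
Proof.
case: mu_std => _ _ _ h3 h4.
by split; [apply: le_trans h3|apply: le_trans h4]; apply: Rintegral_ge0.
Qed.

Section one_summand.
Variables (theta : R) (w : C) (c : R).
Hypotheses (c0 : 0 < c) (cw : c <= complex.Im w).
Let G := cauchy_transform (dilate theta mu) w.
Let th : C := theta%:C%C.

Let w0 : 0 < complex.Im w. Proof. exact: lt_le_trans cw. Qed.
Let wN0 : w != 0. Proof. by rewrite Im_neq0// gt_eqF. Qed.

Let normcVw : Normc.normc w^-1 <= c^-1.
Proof. by have := normc_cauchy_kernel 0 c0 cw; rewrite subr0. Qed.

Let wG : w * G - 1 = th ^+ 2 * (w^-1 * weighted_cauchy mu 2 theta w).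
Proof.
case: mu_std => ik m1 m2 _ _.
rewrite /G cauchy_transform_dilate// weighted_cauchy_rec ?ik//.
have /(canRL (mulKf wN0)) -> :=
  weighted_cauchy_rec theta w0 (ik 1%N isT) (ik 2%N isT).
rewrite m1 (_ : \int[mu]_t _ = 1) ?rintegral_cst// -/th.
by rewrite (_ : real_complex R 0 = 0)// (_ : real_complex R 1 = 1)//; ring.
Qed.

(** The mean vanishes, so [w G(w) - 1] is of second order in [theta]. *)
Lemma summand_first_order : Normc.normc (w * G - 1) <= theta ^+ 2 * c^-1 ^+ 2.
Proof.
case: mu_std => ik _ m2 _ _.
rewrite wG Normc.normcM normcX normc_real real_normK ?num_real//.
rewrite ler_wpM2l ?sqr_ge0// Normc.normcM expr2 ler_pM ?normc_ge0//.
rewrite (le_trans (normc_weighted_cauchy theta c0 cw (ik 2%N isT)))//.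
under eq_Rintegral do rewrite ger0_norm ?sqr_ge0//.
by rewrite m2 mul1r.
Qed.

(** Two further steps of the recursion isolate the third moment; the fourth one
    controls the remainder. *)
Lemma summand_second_order :
  Normc.normc (w * G - 1 - (th ^+ 2 * w^-1 ^+ 2
    + (\int[mu]_t (t ^+ 3))%:C%C * th ^+ 3 * w^-1 ^+ 3))
  <= theta ^+ 4 * b4 * c^-1 ^+ 4.
Proof.
case: mu_std => ik _ m2 _ h4.
have /(canRL (mulKf wN0)) e2 :=
  weighted_cauchy_rec theta w0 (ik 2%N isT) (ik 3%N isT).
have /(canRL (mulKf wN0)) e3 :=
  weighted_cauchy_rec theta w0 (ik 3%N isT) (ik 4%N isT).
have -> : w * G - 1 - (th ^+ 2 * w^-1 ^+ 2
    + (\int[mu]_t (t ^+ 3))%:C%C * th ^+ 3 * w^-1 ^+ 3) =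
    th ^+ 4 * (w^-1 ^+ 3 * weighted_cauchy mu 4 theta w).
  rewrite wG e2 e3 m2 -/th (_ : real_complex R 1 = 1)//; ring.
rewrite Normc.normcM normcX normc_real -normrX ger0_norm; last first.
  by rewrite exprn_even_ge0.
rewrite -mulrA ler_wpM2l ?exprn_even_ge0// Normc.normcM normcX.
have := normc_weighted_cauchy theta c0 cw (ik 4%N isT).
move=> /le_trans/(_ (ler_wpM2r _ h4)); rewrite invr_ge0 => /(_ (ltW c0)) h.
rewrite [leRHS](_ : _ = c^-1 ^+ 3 * (b4 / c)); last by ring.
by rewrite ler_pM ?exprn_ge0 ?normc_ge0// lerXn2r// nnegrE ?normc_ge0// invr_ge0 ltW.
Qed.

(** Replacing [1 / w] by [G] in the expansion costs a further factor
    [theta^2]. *)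
Lemma summand_expansion : c <= 1 -> `|theta| <= 1 -> theta ^+ 2 <= c ^+ 2 ->
  Normc.normc (w * G - 1
    - (th ^+ 2 * G ^+ 2 + (\int[mu]_t (t ^+ 3))%:C%C * G ^+ 3 * th ^+ 3))
  <= theta ^+ 4 * ((3 + 7 * b3 + b4) * c^-1 ^+ 5).
Proof.
move=> c1 th1 thc; have [b30 b40] := standardized_ge0.
have [_ _ _ h3 _] := mu_std.
have := summand_second_order; have := summand_first_order.
set e := w * G - 1; set k := c^-1; set m3 := \int[mu]_t (t ^+ 3).
move=> ne h.
have k1 : 1 <= k by rewrite invf_ge1.
have k0 : 0 <= k by lra.
have nm3 : `|m3| <= b3.
  apply: le_trans h3; apply: le_normr_Rintegral => //.
  by case: mu_std => + _ _ _ _; exact.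
have Ge : G = w^-1 * (1 + e) by rewrite /e addrC subrK mulKf.
have e1 : Normc.normc e <= 1.
  apply: (le_trans ne); rewrite -exprMn -[leRHS](expr1n _ 2).
  have : theta ^+ 2 * k ^+ 2 <= c ^+ 2 * k ^+ 2 by rewrite ler_wpM2r// exprn_ge0.
  by rewrite -!exprMn mulfV ?gt_eqF.
have d2 : Normc.normc (w^-1 ^+ 2 - G ^+ 2) <= k ^+ 2 * (theta ^+ 2 * k ^+ 2 * 3).
  have -> : w^-1 ^+ 2 - G ^+ 2 = w^-1 ^+ 2 * (- e * (2 + e)) by rewrite Ge; ring.
  rewrite Normc.normcM normcX ler_pM ?exprn_ge0 ?normc_ge0//.
    by rewrite lerXn2r// nnegrE normc_ge0.
  rewrite Normc.normcM normc_opp ler_pM ?normc_ge0//.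
  apply: (le_trans (normcD _ _)).
  rewrite normc_nat; lra.
have d3 : Normc.normc (w^-1 ^+ 3 - G ^+ 3) <= k ^+ 3 * (theta ^+ 2 * k ^+ 2 * 7).
  have -> : w^-1 ^+ 3 - G ^+ 3 = w^-1 ^+ 3 * (- e * (3 + (3 * e + e ^+ 2))).
    by rewrite Ge; ring.
  rewrite Normc.normcM normcX ler_pM ?exprn_ge0 ?normc_ge0//.
    by rewrite lerXn2r// nnegrE normc_ge0.
  rewrite Normc.normcM normc_opp ler_pM ?normc_ge0//.
  apply: (le_trans (normcD _ _)).
  have := normcD (3 * e) (e ^+ 2).
  rewrite Normc.normcM normcX normc_nat.
  have : Normc.normc e ^+ 2 <= 1 by rewrite expr_le1// normc_ge0.
  lra.
rewrite (_ : e - _ =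
    (e - (th ^+ 2 * w^-1 ^+ 2 + m3%:C%C * th ^+ 3 * w^-1 ^+ 3)) +
    (th ^+ 2 * (w^-1 ^+ 2 - G ^+ 2) +
     m3%:C%C * th ^+ 3 * (w^-1 ^+ 3 - G ^+ 3))); last by ring.
apply: (le_trans (normcD _ _)).
have -> : theta ^+ 4 * ((3 + 7 * b3 + b4) * k ^+ 5) =
    theta ^+ 4 * b4 * k ^+ 5 + (theta ^+ 4 * 3 * k ^+ 5 + theta ^+ 4 * 7 * b3 * k ^+ 5).
  by ring.
have k45 : k ^+ 4 <= k ^+ 5 by rewrite ler_weXn2l.
have th4 : 0 <= theta ^+ 4 by rewrite exprn_even_ge0.
apply: lerD.
  by apply: (le_trans h); rewrite ler_wpM2l// mulr_ge0.
apply: (le_trans (normcD _ _)); apply: lerD.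
  rewrite Normc.normcM normcX normc_real real_normK ?num_real//.
  apply: (le_trans (ler_wpM2l (sqr_ge0 _) d2)).
  rewrite [leLHS](_ : _ = theta ^+ 4 * 3 * k ^+ 4); last by ring.
  by rewrite ler_wpM2l// mulr_ge0.
rewrite 2!Normc.normcM normcX !normc_real.
have th3 : `|theta| ^+ 3 <= theta ^+ 2.
  by rewrite exprS real_normK ?num_real// ler_piMl// sqr_ge0.
apply: (@le_trans _ _ (b3 * theta ^+ 2 * (k ^+ 3 * (theta ^+ 2 * k ^+ 2 * 7)))).
  by rewrite ler_pM ?mulr_ge0 ?exprn_ge0 ?normc_ge0// ler_pM ?exprn_ge0.
by rewrite le_eqVlt; apply/orP; left; apply/eqP; ring.
Qed.

End one_summand.

Section subordination.
Variables (n : nat) (theta : 'I_n -> R) (nu : probR R) (z : C) (Z : 'I_n -> C).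
Hypotheses (z0 : 0 < complex.Im z) (Z0 : forall i, 0 < complex.Im (Z i)).
Hypothesis Zsum : \sum_(i < n) Z i - z = (n%:R - 1) * F_transform nu z.
Hypothesis Zsub :
  forall i, F_transform nu z = F_transform (dilate (theta i) mu) (Z i).
Let G := cauchy_transform nu z.

Let G0 : G != 0. Proof. exact: cauchy_transform_neq0. Qed.

Let GE i : G = cauchy_transform (dilate (theta i) mu) (Z i).
Proof. exact: invr_inj (Zsub i). Qed.

(** Every subordination function increases imaginary parts: each [F] does, and
    the [n] differences [Im F - Im Z_j] add up to [Im F - Im z]. *)
Lemma subordination_Im i : complex.Im z <= complex.Im (Z i).
Proof.
have ZF j : complex.Im (Z j) <= complex.Im (F_transform nu z).
  by rewrite (Zsub j) Im_F_transform.
have : complex.Im (\sum_(j < n) (F_transform nu z - Z j)) =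
    complex.Im (F_transform nu z) - complex.Im z.
  rewrite -ImB big_split/= sumr_const card_ord sumrN; congr complex.Im.
  move/eqP: Zsum; rewrite subr_eq => /eqP ->.
  by rewrite -mulr_natl; ring.
have : 0 <= \sum_(j < n | j != i) complex.Im (F_transform nu z - Z j).
  by apply: sumr_ge0 => j _; rewrite ImB subr_ge0.
move: (F_transform nu z) => F h0; rewrite Im_sum (bigD1 i)//= ImB.
lra.
Qed.

Variable c : R.
Hypotheses (c0 : 0 < c) (c1 : c <= 1) (cZ : forall i, c <= complex.Im (Z i)).
Hypothesis theta_small : forall i, theta i ^+ 2 <= c ^+ 2.
Hypothesis theta1 : \sum_(i < n) theta i ^+ 2 = 1.

(** Summing the expansions over all summands turns the subordination equations
    into a perturbation of the equation [G^2 - z G + 1 = 0] of the semicircle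
    law, the first Edgeworth correction being carried by [\sum theta_i^3]. *)
Lemma approx_quadratic :
  Normc.normc (G ^+ 2 - z * G + 1) <=
    b3 * c^-1 ^+ 3 * `|\sum_(i < n) theta i ^+ 3| +
    (3 + 7 * b3 + b4) * c^-1 ^+ 5 * \sum_(i < n) theta i ^+ 4.
Proof.
have [b30 b40] := standardized_ge0.
set m3 : C := (\int[mu]_t (t ^+ 3))%:C%C.
pose th i : C := (theta i)%:C%C.
pose rho i := Z i * G - 1 - (th i ^+ 2 * G ^+ 2 + m3 * G ^+ 3 * th i ^+ 3).
have sumth2 : \sum_(i < n) th i ^+ 2 = 1.
  rewrite (_ : 1 = (1 : R)%:C%C :> C)// -theta1 rmorph_sum.
  by apply: eq_bigr => i _; rewrite /th -rmorphXn.
have sumth3 : \sum_(i < n) th i ^+ 3 = (\sum_(i < n) theta i ^+ 3)%:C%C.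
  by rewrite rmorph_sum; apply: eq_bigr => i _; rewrite /th -rmorphXn.
have sumZ : \sum_(i < n) (Z i * G - 1) = z * G - 1.
  rewrite big_split/= sumrN sumr_const card_ord -mulr_suml.
  move/eqP: Zsum; rewrite subr_eq => /eqP ->.
  by rewrite mulrDl -mulrA /F_transform mulVf// mulr1 -mulr_natl; ring.
have -> : G ^+ 2 - z * G + 1 =
    - (m3 * G ^+ 3 * (\sum_(i < n) theta i ^+ 3)%:C%C + \sum_(i < n) rho i).
  rewrite /rho sumrB sumZ big_split/= -mulr_suml -mulr_sumr sumth2 sumth3.
  by rewrite mul1r; ring.
rewrite normc_opp; apply: (le_trans (normcD _ _)); apply: lerD.
  rewrite 2!Normc.normcM normcX !normc_real ler_wpM2r//.
  have [_ _ _ h3 _] := mu_std.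
  have nG : Normc.normc G <= c^-1.
    have [i _|n0] := pickP 'I_n; first by rewrite (GE i) normc_cauchy_transform.
    by move: theta1; rewrite big1 => [/eqP|i _]; [rewrite eq_sym oner_eq0|have := n0 i].
  apply: ler_pM; rewrite ?exprn_ge0 ?normc_ge0//; last first.
    by rewrite lerXn2r// nnegrE ?normc_ge0// invr_ge0 ltW.
  apply: le_trans h3; apply: le_normr_Rintegral => //.
  by case: mu_std => + _ _ _ _; exact.
apply: (le_trans (normc_sum _)); rewrite mulr_sumr; apply: ler_sum => i _.
rewrite /rho (GE i) [leRHS]mulrC.
apply: summand_expansion => //.
have : theta i ^+ 2 <= 1 by apply: (le_trans (theta_small i)); rewrite expr_le1// ltW.
by rewrite -real_normK ?num_real// expr_le1.
Qed.

(** The subordination functions cannot touch the level [c = eps / 16]: while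
    they are at or above it, the quadratic equation gives [Im F >= 2 c], and
    [Z_i] differs from [F] by [O(theta_i^2)]. *)
Lemma subordination_gap (eps eta : R) :
  0 < eps < 1 -> c = eps / 16 -> eta <= eps / 24 ->
  (forall i, 7 * theta i ^+ 2 <= c ^+ 3) ->
  `|complex.Re z| <= 2 - eps -> Normc.normc z <= 3 ->
  b3 * c^-1 ^+ 3 * `|\sum_(i < n) theta i ^+ 3| +
    (3 + 7 * b3 + b4) * c^-1 ^+ 5 * \sum_(i < n) theta i ^+ 4 <= eta ->
  forall i, c < complex.Im (Z i).
Proof.
move=> epsP ceps etaeps th7 Rez nz resid i.
have ImG : complex.Im G < 0 by exact: Im_cauchy_transform_lt0.
have [_ nF ImF] := quadratic_root_away epsP etaeps Rez nz ImG
  (le_trans approx_quadratic resid).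
have ne : Normc.normc (Z i * G - 1) <= theta i ^+ 2 * c^-1 ^+ 2.
  by rewrite (GE i); exact: summand_first_order.
have ZE : Z i = G^-1 + G^-1 * (Z i * G - 1).
  by rewrite mulrBr mulr1 addrC subrK mulrCA mulVf ?mulr1.
have : Normc.normc (G^-1 * (Z i * G - 1)) <= 6 * (theta i ^+ 2 * c^-1 ^+ 2).
  by rewrite Normc.normcM ler_pM ?normc_ge0.
(* The bound [|F| <= 6] loses a factor 6 against the 7 of the hypothesis, which
   leaves a strict inequality. *)
have th7c : 7 * (theta i ^+ 2 * c^-1 ^+ 2) <= c.
  rewrite mulrA [leRHS](_ : c = c ^+ 3 * c^-1 ^+ 2); last first.
    by field; rewrite gt_eqF.
  by apply: ler_wpM2r; [exact: sqr_ge0|exact: th7].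
have th0 : 0 <= theta i ^+ 2 * c^-1 ^+ 2.
  by rewrite mulr_ge0 ?sqr_ge0.
have := normc_Im (G^-1 * (Z i * G - 1)); rewrite ler_norml => /andP[+ _].
move: (congr1 (@complex.Im _) ZE); rewrite ImD.
lra.
Qed.

End subordination.

End quadratic_equation.

(** * From the upper half-plane to the real axis *)

Section vertical_continuity.
Context {R : realType}.
Local Notation C := R[i].

Lemma holomorphic_Im_vertical (U : set C) (f : C -> C) (x y : R) :
  holomorphic_on U f -> U (Complex x y) ->
  {for y, continuous (fun t : R => complex.Im (f (Complex x t)))}.
Proof.
move=> hf Uz; have /derivable1_diffP/differentiable_continuous := hf _ Uz.
move=> /(@cvgrPdist_lt _ C^o) cf; apply/(@cvgrPdist_lt _ R^o) => e e0.
have e0' : (0 : C) < e%:C%C by rewrite ltcR.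
have /nbhs_normP[d /= d0 df] := cf _ e0'.
have [dr dim] : 0 < complex.Re d /\ d = (complex.Re d)%:C%C.
  case: d d0 {df} => a b; rewrite ltcE /= => /andP[/eqP -> ->]; split => //.
apply/nbhs_normP; exists (complex.Re d) => //= t yt.
have /df : `|(Complex x y : C^o) - Complex x t| < d.
  rewrite [X in _ < X]dim -[`|_|]/((Normc.normc (Complex x y - Complex x t))%:C%C).
  rewrite ltcR.
  have -> : Complex x y - Complex x t = Complex 0 (y - t) :> C.
    by apply/eqP; rewrite eq_complex/= subrr !eqxx.
  by rewrite /= expr0n add0r sqrtr_sqr.
rewrite /= -[`|f _ - _|]/((Normc.normc (f (Complex x y) - f (Complex x t)))%:C%C).
rewrite ltcR => fe; apply: le_lt_trans fe.
by rewrite -ImB normc_Im.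
Qed.

Lemma continuous_bigmin (n : nat) (h : 'I_n -> R -> R) (b y : R) :
  (forall i, {for y, continuous (h i)}) ->
  {for y, continuous (fun t => \big[Num.min/b]_(i < n) h i t)}.
Proof.
move=> hc; have -> : (fun t => \big[Num.min/b]_(i < n) h i t) =
    \big[(fun f g : R -> R => fun t => Num.min (f t) (g t))/cst b]_(i < n) h i.
  apply/funext => t; elim/big_ind2 : _ => //.
  by move=> f r g s <- <-.
elim/big_ind : _ => //; first exact: cvg_cst.
by move=> f g fc gc; exact: continuous_min.
Qed.

(** Before falling below [c], the minimum of the [h i] would have to take the
    value [c] by the intermediate value theorem, which the gap excludes. *)
Lemma barrier (n : nat) (h : 'I_n -> R -> R) (c : R) :
  c < 1 -> (forall i y, 0 < y -> {for y, continuous (h i)}) ->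
  (forall i, 1 <= h i 1) ->
  (forall y, 0 < y -> y <= 1 -> (forall i, c <= h i y) -> forall i, c < h i y) ->
  forall y, 0 < y -> y <= 1 -> forall i, c <= h i y.
Proof.
move=> c1 hc h1 hgap y0 y00 y01 i; rewrite leNgt; apply/negP => hi.
pose m t := \big[Num.min/1]_(j < n) h j t.
have mc : {within `[y0, 1], continuous m}.
  apply: continuous_in_subspaceT => t; rewrite inE/= in_itv/= => /andP[y0t _].
  by apply: continuous_bigmin => j; apply: hc; exact: lt_le_trans y0t.
have m0 : m y0 < c.
  by apply: le_lt_trans hi; rewrite /m (bigD1 i)//= ge_min lexx.
have m1 : c <= m 1.
  rewrite /m; apply/bigmin_geP; split=> [|j _]; first exact: ltW.
  exact: le_trans (ltW c1) (h1 j).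
have [|t] := @IVT R m y0 1 c y01 mc.
  by rewrite ge_min (ltW m0) le_max m1 orbT.
rewrite in_itv/= => /andP[y0t t1] mt.
have t0 : 0 < t by exact: lt_le_trans y0t.
have ht j : c <= h j t by rewrite -mt /m (bigD1 j)//= ge_min lexx.
suff : c < m t by rewrite mt ltxx.
by rewrite /m; apply/lt_bigmin => // j _; exact: hgap.
Qed.

End vertical_continuity.

Section interior_estimate.
Context {R : realType}.
Local Notation C := R[i].
Variables (mu : probR R) (b3 b4 eps eta : R) (n : nat) (theta : 'I_n -> R).
Variable nu : probR R.
Hypothesis mu_std : standardized mu b3 b4.
Hypothesis eps01 : 0 < eps < 1.
Let c := eps / 16.
Hypothesis eta_eps : eta <= eps / 24.
Hypothesis theta_small : forall i, 7 * theta i ^+ 2 <= c ^+ 3.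
Hypothesis theta1 : \sum_(i < n) theta i ^+ 2 = 1.
Hypothesis residual :
  b3 * c^-1 ^+ 3 * `|\sum_(i < n) theta i ^+ 3| +
    (3 + 7 * b3 + b4) * c^-1 ^+ 5 * \sum_(i < n) theta i ^+ 4 <= eta.
Hypothesis nu_conv : is_free_convolution (fun i => dilate (theta i) mu) nu.

(** At height 1 subordination alone gives [Im Z_i >= 1]; descending towards the
    real axis, the barrier argument keeps [Im Z_i >= c], so the quadratic
    equation stays available down to the axis. *)
Lemma cauchy_transform_interior x y : `|x| <= 2 - eps -> 0 < y -> y <= 1 ->
  `| - complex.Im (cauchy_transform nu (Complex x y)) - Num.sqrt (4 - x ^+ 2) / 2|
  <= 2 * (eta + 4 * y) / eps.
Proof.
move=> xle y0 y1; have [Z [Zup Zhol Zsum Zsub]] := nu_conv.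
have /andP[eps0 eps1] := eps01.
have c0 : 0 < c by rewrite divr_gt0.
have c1 : c < 1 by rewrite /c; lra.
have up t : 0 < t -> upper_half_plane (Complex x t) by [].
have thc i : theta i ^+ 2 <= c ^+ 2.
  have : c ^+ 3 <= c ^+ 2 by rewrite exprS ler_piMl ?sqr_ge0// ltW.
  have := theta_small i; have := sqr_ge0 (theta i); lra.
have nz t : 0 < t -> t <= 1 -> Normc.normc (Complex x t) <= 3.
  move=> t0 t1; rewrite -(ler_pXn2r (_ : 0 < 2)%N) ?nnegrE ?normc_ge0//.
  rewrite normc_sqr /=.
  have x2 : `|x| ^+ 2 <= 2 ^+ 2 by rewrite lerXn2r ?nnegrE//; lra.
  rewrite real_normK ?num_real// in x2.
  have : t ^+ 2 <= 1 by rewrite expr_le1// ltW.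
  lra.
have Zge : forall t, 0 < t -> t <= 1 -> forall i, c <= complex.Im (Z i (Complex x t)).
  apply: barrier => //.
  - by move=> i t t0; apply: holomorphic_Im_vertical (Zhol i) _; exact: up.
  - move=> i; have u1 := up 1 ltr01.
    apply: (subordination_Im (z := Complex x 1) (Z := fun i => Z i (Complex x 1))
      _ (Zsum _ u1) (Zsub _ u1)) => j; exact: Zup.
  - move=> t t0 t1 Zc; have ut := up t t0.
    exact: (subordination_gap mu_std (Z := fun i => Z i (Complex x t)) ut
      (Zsum _ ut) (Zsub _ ut) c0 (ltW c1) Zc thc theta1
      eps01 erefl eta_eps theta_small xle (nz t t0 t1) residual).
have uy := up y y0.
have quad := approx_quadratic mu_std uy (Zsum _ uy) (Zsub _ uy) c0 (ltW c1)
  (Zge y y0 y1) thc theta1.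
have ImG := Im_cauchy_transform_lt0 nu (uy : 0 < complex.Im _).
have resid := le_trans quad residual.
have [nG _ _] := quadratic_root_away (z := Complex x y) eps01 eta_eps xle
  (nz y y0 y1) ImG resid.
by apply: quadratic_root_near => //; exact: ltW.
Qed.

End interior_estimate.

(** * Stieltjes inversion *)

Section poisson_kernel.
Context {R : realType}.
Local Notation C := R[i].
Local Notation leb := (@lebesgue_measure R).
Implicit Types a b x y t : R.

Definition poisson_kernel y x t : R := y * ((x - t) ^+ 2 + y ^+ 2)^-1.

Lemma poisson_kernel_ge0 y x t : 0 <= y -> 0 <= poisson_kernel y x t.
Proof. by move=> y0; rewrite mulr_ge0// invr_ge0 addr_ge0 ?sqr_ge0. Qed.

Lemma continuous_poisson_kernel y t : 0 < y ->
  continuous (fun x => poisson_kernel y x t).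
Proof.
move=> y0 x; apply: cvgMl_tmp; apply: cvgV.
  by rewrite gt_eqF// ltr_wpDl ?sqr_ge0// exprn_gt0.
apply: cvgD; last exact: cvg_cst.
apply: (@continuous_comp _ _ _ (fun x : R => x - t) (fun x => x ^+ 2)).
  by apply: cvgB; [exact: cvg_id|exact: cvg_cst].
exact: exprn_continuous.
Qed.

Lemma measurable_poisson_kernel y : 0 < y ->
  measurable_fun [set: measurableTypeR R * measurableTypeR R]
    (fun xt => poisson_kernel y xt.1 xt.2).
Proof.
move=> y0; apply: measurable_funM => //.
apply: (@measurableT_comp _ _ _ _ _ _ (fun u : R => (u ^+ 2 + y ^+ 2)^-1) _
  (fun xt : measurableTypeR R * measurableTypeR R => xt.1 - xt.2)).
  apply: continuous_measurable_fun => u; apply: cvgV.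
    by rewrite gt_eqF// ltr_wpDl ?sqr_ge0// exprn_gt0.
  by apply: cvgD; [exact: exprn_continuous|exact: cvg_cst].
by apply: measurable_funB.
Qed.

Definition poisson_mass a b y t : R := atan ((b - t) / y) - atan ((a - t) / y).

Lemma poisson_mass_ge0 a b y t : a <= b -> 0 < y -> 0 <= poisson_mass a b y t.
Proof.
by move=> ab y0; rewrite subr_ge0 le_atan// ler_pM2r ?invr_gt0// lerD2r.
Qed.

Lemma poisson_mass_le a b y t : poisson_mass a b y t <= pi.
Proof.
rewrite /poisson_mass; have := atan_ltpi2 ((b - t) / y).
have := atan_gtNpi2 ((a - t) / y); lra.
Qed.

Lemma measurable_poisson_mass a b y :
  measurable_fun [set: measurableTypeR R] (poisson_mass a b y).
Proof.
have matan : measurable_fun [set: R] (@atan R).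
  by apply: continuous_measurable_fun; exact: continuous_atan.
by apply: measurable_funB;
  apply: (measurableT_comp matan); apply: measurable_funM => //;
  apply: measurable_funB.
Qed.

Lemma integral_poisson_kernel a b y t : a < b -> 0 < y ->
  (\int[leb]_(x in `]a, b]) (poisson_kernel y x t)%:E = (poisson_mass a b y t)%:E)%E.
Proof.
move=> ab y0; rewrite integral_itv_obnd_cbnd; last first.
  apply/measurable_EFinP; apply: measurable_funTS.
  by apply: continuous_measurable_fun; exact: continuous_poisson_kernel.
have dF (x : R) : is_derive x (1 : R) (fun x => atan ((x - t) / y))
    (poisson_kernel y x t).
  apply: is_derive_eq; rewrite /GRing.scale/= /poisson_kernel.
  by field; rewrite !gt_eqF// ltr_wpDl ?sqr_ge0// exprn_gt0.
have cF : continuous (fun x => atan ((x - t) / y)).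
  by move=> x; apply/differentiable_continuous/derivable1_diffP; exact: ex_derive.
rewrite (@continuous_FTC2 _ _ (fun x => atan ((x - t) / y)))//.
- by apply: continuous_subspaceT; exact: continuous_poisson_kernel.
- split.
  + by move=> x _; exact: ex_derive.
  + by apply: cvg_at_right_filter; exact: cF.
  + by apply: cvg_at_left_filter; exact: cF.
- by move=> x _; rewrite derive1E; exact: derive_val.
Qed.

Lemma cvg_atan_scale (u : R) : 0 < u ->
  atan (u * k.+1%:R) @[k --> \oo] --> pi / 2.
Proof.
move=> u0; apply: (@cvg_comp _ _ _ (fun k : nat => k.+1%:R : R)
    (fun r => atan (u * r)) _ +oo).
  by rewrite (@cvg_shiftS R (fun k => k%:R)); exact: cvgr_idn.
apply: (@cvg_comp _ _ _ (fun r => u * r) (@atan R) _ +oo); last exact: cvgy_atan.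
by apply: gt0_cvgMry => //; exact: cvg_id.
Qed.

(** The Poisson kernels are an approximate identity; at the end points of the
    interval only half of the mass survives. *)
Lemma cvg_poisson_mass a b t : t != a -> t != b -> a <= b ->
  poisson_mass a b k.+1%:R^-1 t @[k --> \oo] --> pi * \1_(`]a, b]) t.
Proof.
move=> ta tb ab.
have -> : (fun k : nat => poisson_mass a b k.+1%:R^-1 t) =
    (fun k => atan ((b - t) * k.+1%:R) - atan ((a - t) * k.+1%:R)).
  by apply/funext => k; rewrite /poisson_mass !invrK.
have atan_neg (u : R) : u < 0 -> atan (u * k.+1%:R) @[k --> \oo] --> - (pi / 2).
  move=> u0; have -> : (fun k : nat => atan (u * k.+1%:R)) =
      (fun k => - atan (- u * k.+1%:R)).
    by apply/funext => k; rewrite mulNr atanN opprK.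
  by apply: cvgN; apply: cvg_atan_scale; rewrite oppr_gt0.
have [ta'|at'] : t < a \/ a < t.
  by apply/orP; rewrite -neq_lt.
- have -> : pi * \1_(`]a, b]) t = pi / 2 - pi / 2 :> R.
    rewrite indicE memNset ?mulr0 ?subrr//.
    by rewrite /= in_itv/= => /andP[/lt_trans/(_ ta')]; rewrite ltxx.
  apply: cvgB; apply: cvg_atan_scale; rewrite subr_gt0//.
  exact: lt_le_trans ab.
have [tb'|bt'] : t < b \/ b < t.
  by apply/orP; rewrite -neq_lt.
- have -> : pi * \1_(`]a, b]) t = pi / 2 - - (pi / 2) :> R.
    by rewrite indicE mem_set ?mulr1; [field|rewrite /= in_itv/= at' ltW].
  by apply: cvgB; [apply: cvg_atan_scale|apply: atan_neg];
    rewrite ?subr_gt0 ?subr_lt0.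
- have -> : pi * \1_(`]a, b]) t = - (pi / 2) - - (pi / 2) :> R.
    rewrite indicE memNset ?mulr0 ?subrr//.
    by rewrite /= in_itv/= => /andP[_]; rewrite leNgt bt'.
  by apply: cvgB; apply: atan_neg; rewrite subr_lt0.
Qed.

End poisson_kernel.

Section stieltjes_inversion.
Context {R : realType}.
Local Notation leb := (@lebesgue_measure R).
Variable nu : probR R.

Let G x y := cauchy_transform nu (Complex x y).

Lemma Im_cauchy_transform_poisson x y : 0 < y ->
  ((- complex.Im (G x y))%:E = \int[nu]_t (poisson_kernel y x t)%:E)%E.
Proof.
move=> y0.
have [_ ii] := cintegrable_cauchy_kernel nu (y0 : 0 < complex.Im (Complex x y)).
rewrite -mulN1r -rintegralZ// /Rintegral fineK; last first.
  by apply: integrable_fin_num => //; exact: rintegrableZ.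
apply: eq_integral => t _; rewrite Im_cauchy_kernel /poisson_kernel/=.
by rewrite mulrA mulN1r opprK.
Qed.

Lemma integral_Im_cauchy_transform a b y : a < b -> 0 < y ->
  (\int[leb]_(x in `]a, b]) (- complex.Im (G x y))%:E =
   \int[nu]_t (poisson_mass a b y t)%:E)%E.
Proof.
move=> ab y0.
pose D := `]a, b]%classic : set (measurableTypeR R).
pose f (xt : measurableTypeR R * measurableTypeR R) : \bar R :=
  ((poisson_kernel y xt.1 xt.2 * \1_D xt.1)%:E)%E.
transitivity (\int[leb]_x \int[nu]_t f (x, t))%E.
  rewrite integral_mkcond; apply: eq_integral => x _.
  rewrite patchE /f /D /= indicE; case: ifPn => xD.
    rewrite Im_cauchy_transform_poisson//.
    by apply: eq_integral => t _; rewrite ?xD mulr1.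
  by rewrite ?(negbTE xD) integral0_eq// => t _; rewrite mulr0.
rewrite fubini_tonelli; first last.
- by move=> xt; rewrite lee_fin mulr_ge0// poisson_kernel_ge0// ltW.
- apply/measurable_EFinP; apply: measurable_funM.
    exact: measurable_poisson_kernel.
  have mD : measurable_fun setT (\1_D : measurableTypeR R -> R).
    by apply: measurable_indic; exact: measurable_itv.
  exact: (measurableT_comp mD (@measurable_fst _ _ _ _)).
apply: eq_integral => t _; rewrite -integral_poisson_kernel//.
rewrite [RHS]integral_mkcond; apply: eq_integral => x _.
by rewrite patchE /f /D /= indicE; case: ifPn => xD; rewrite ?mulr1 ?mulr0.
Qed.

(** An atom at [x] makes [- Im G] blow up like [1 / y] above [x]. *)
Lemma cauchy_transform_no_atom x M :
  (forall y, 0 < y -> y <= 1 -> - complex.Im (G x y) <= M) ->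
  nu [set x] = 0%E.
Proof.
move=> GM; pose p := fine (nu [set x]).
have pE : nu [set x] = p%:E by rewrite fineK// fin_num_measure.
have p0 : 0 <= p by rewrite fine_ge0.
suff p_le : p <= 0 by rewrite pE; congr EFin; apply/eqP; rewrite eq_le p_le.
have pM y : 0 < y -> y <= 1 -> p <= y * M.
  move=> y0 y1; rewrite mulrC -ler_pdivrMr//; apply: le_trans (GM y y0 y1).
  rewrite -lee_fin Im_cauchy_transform_poisson//.
  have -> : (p / y)%:E = (\int[nu]_(t in [set x]) (poisson_kernel y x t)%:E)%E.
    transitivity (\int[nu]_(t in [set x]) (y^-1)%:E)%E.
      by rewrite integral_cst//= pE -EFinM mulrC.
    apply: eq_integral => t; rewrite inE/= => ->.
    rewrite /poisson_kernel subrr expr0n add0r; congr EFin; field.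
    by rewrite gt_eqF.
  apply: ge0_subset_integral => //.
    apply/measurable_EFinP.
    exact: (measurableT_comp (measurable_poisson_kernel y0) (measurable_pair1 x)).
  by move=> t _; rewrite lee_fin poisson_kernel_ge0// ltW.
have M0 : 0 <= M by have := pM 1 ltr01 (lexx _); rewrite mul1r; exact: le_trans.
rewrite leNgt; apply/negP => p_gt0.
pose y := p / (2 * (M + p)).
have Mp : 0 < 2 * (M + p) by lra.
have y0 : 0 < y by rewrite divr_gt0.
have y1 : y <= 1 by rewrite ler_pdivrMr//; lra.
have := pM y y0 y1; rewrite mulrAC ler_pdivlMr//; nra.
Qed.

Lemma integral_poisson_mass_cvg (a b : R) : a <= b ->
  nu [set a] = 0%E -> nu [set b] = 0%E ->
  (\int[nu]_t (poisson_mass a b k.+1%:R^-1 t)%:E)%E @[k --> \oo]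
    --> (pi%:E * nu `]a, b]%classic)%E.
Proof.
move=> ab nua nub.
pose f_ k (t : measurableTypeR R) := (poisson_mass a b k.+1%:R^-1 t)%:E.
pose f (t : measurableTypeR R) : \bar R := (pi * \1_(`]a, b]%classic) t)%:E.
have mf_ k : measurable_fun setT (f_ k).
  by apply/measurable_EFinP; exact: measurable_poisson_mass.
have mf : measurable_fun setT f.
  by apply/measurable_EFinP; apply: measurable_funM => //; exact: measurable_indic.
have [] := @dominated_convergence _ _ _ nu setT measurableT f_ f (cst pi%:E)
  mf_ mf _ _ _.
- exists ([set a] `|` [set b]); split; first exact: measurableU.
    by rewrite measureU0.
  move=> t /=; apply: contra_notP => /not_orP[/eqP ta /eqP tb] _.
  apply: cvg_EFin; first by apply: nearW.
  exact: cvg_poisson_mass.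
- exact: rintegrable_cst.
- apply: aeW => t k _ /=; rewrite lee_fin ger0_norm ?poisson_mass_le//.
  by rewrite poisson_mass_ge0.
move=> _ _; rewrite (_ : (\int[nu]_t f t)%E = (pi%:E * nu `]a, b]%classic)%E)//.
rewrite /f; under eq_integral do rewrite EFinM.
rewrite ge0_integralZl//; first last.
- by rewrite lee_fin pi_ge0.
- by apply/measurable_EFinP; exact: measurable_indic.
by rewrite integral_indic// setIT.
Qed.

(** The integral of [- Im G] over the interval at height [y] is the Poisson
    smoothing of [pi nu]; it converges to [pi nu (a, b]] because the hypothesis
    excludes atoms at the end points. *)
Lemma stieltjes_density_bound (p : R -> R) (a b A B : R) : a <= b ->
  continuous p ->
  (forall x y, a <= x <= b -> 0 < y -> y <= 1 ->
    `| - complex.Im (G x y) - pi * p x | <= A + B * y) ->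
  `| fine (nu `]a, b]%classic) - \int[leb]_(x in `]a, b]) p x |
    <= (b - a) * A / pi.
Proof.
rewrite le_eqVlt => /predU1P[<- cp _|ab cp Gp].
  rewrite set_itvoc0 measure0 Rintegral_set0 subrr normr0.
  by rewrite subrr !mul0r.
set D : set (measurableTypeR R) := `]a, b]%classic.
have mD : measurable D by exact: measurable_itv.
have DI x : D x -> a <= x <= b by rewrite /D/= in_itv/= => /andP[/ltW -> ->].
have icont q : continuous q -> leb.-integrable D (EFin \o q).
  move=> cq.
  have sub : D `<=` `[a, b]%classic by move=> x /DI; rewrite /= in_itv.
  have mE : measurable (`[a, b]%classic : set (measurableTypeR R)).
    exact: measurable_itv.
  apply: (integrableS mE mD sub).
  apply: continuous_compact_integrable; first exact: segment_compact.
  exact: continuous_subspaceT.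
have ip := icont p cp.
have leD : fine (leb D) = b - a by rewrite /D lebesgue_measure_itv/= lte_fin ab.
have atom x : a <= x <= b -> nu [set x] = 0%E.
  move=> xab; apply: (@cauchy_transform_no_atom _ (pi * p x + A + `|B|)) => y y0 y1.
  have := Gp x y xab y0 y1; rewrite ler_norml => /andP[_].
  have : B * y <= `|B|.
    apply: (@le_trans _ _ (`|B| * y)); last by rewrite ler_piMr.
    by rewrite ler_wpM2r ?ler_norm// ltW.
  lra.
pose y_ k : R := k.+1%:R^-1.
have y_0 k : 0 < y_ k by rewrite invr_gt0.
have y_1 k : y_ k <= 1 by rewrite invf_le1// ler1n.
have iG k : leb.-integrable D (fun x => (- complex.Im (G x (y_ k)))%:E).
  apply/integrableP; split.
    apply: measurable_funTS.
    under eq_fun do rewrite Im_cauchy_transform_poisson//.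
    apply: (@measurable_fun_fubini_tonelli_F _ _ (measurableTypeR R)
      (measurableTypeR R) R nu
      (fun xt => (poisson_kernel (y_ k) xt.1 xt.2)%:E)).
      by apply/measurable_EFinP; exact: measurable_poisson_kernel.
    by move=> xt; rewrite lee_fin poisson_kernel_ge0// ltW.
  have G0 x : (0 <= (- complex.Im (G x (y_ k)))%:E)%E.
    by rewrite lee_fin oppr_ge0; apply/ltW/Im_cauchy_transform_lt0/y_0.
  under eq_integral => x _ do rewrite (gee0_abs (G0 x)).
  rewrite integral_Im_cauchy_transform//.
  apply: (@le_lt_trans _ _ (\int[nu]_t (pi : R)%:E)%E).
    apply: ge0_le_integral => //.
    - by move=> t _; rewrite lee_fin poisson_mass_ge0// ltW.
    - by apply/measurable_EFinP; exact: measurable_poisson_mass.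
    - by move=> t _; rewrite lee_fin poisson_mass_le.
  by rewrite integral_cst//= probability_setT mule1 ltry.
have close k : `| \int[leb]_(x in D) (- complex.Im (G x (y_ k)))
    - pi * \int[leb]_(x in D) p x | <= (A + B * y_ k) * (b - a).
  have ip' : leb.-integrable D (EFin \o (fun x => pi * p x)).
    exact: (integrableZl mD pi ip).
  rewrite -leD -Rintegral_cst// -RintegralZl// -RintegralB//; last exact: iG.
  have iB := integrableB mD (iG k) ip'.
  apply: (le_trans (le_normr_Rintegral mD iB)).
  apply: le_Rintegral => //.
  - exact: (integrable_norm iB).
  - by apply: (icont (cst _)) => x; exact: cvg_cst.
  - by move=> x Dx; apply: Gp => //; exact: DI.
have limG : \int[leb]_(x in D) (- complex.Im (G x (y_ k))) @[k --> \oo]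
    --> pi * fine (nu D).
  have -> : pi * fine (nu D) = fine (pi%:E * nu D)%E.
    by rewrite fineM// fin_num_measure.
  apply: fine_cvg; rewrite fineK; last by rewrite fin_numM// fin_num_measure.
  under eq_fun do rewrite integral_Im_cauchy_transform//.
  by apply: integral_poisson_mass_cvg; rewrite ?(ltW ab)//; apply: atom;
    rewrite lexx (ltW ab).
have limL : `| \int[leb]_(x in D) (- complex.Im (G x (y_ k)))
    - pi * \int[leb]_(x in D) p x | @[k --> \oo]
    --> `| pi * fine (nu D) - pi * \int[leb]_(x in D) p x |.
  by apply: cvg_norm; apply: cvgB limG _; exact: cvg_cst.
have limR : (A + B * y_ k) * (b - a) @[k --> \oo] --> (A + B * 0) * (b - a).
  apply: cvgMr_tmp; apply: cvgD; first exact: cvg_cst.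
  by apply: cvgMl_tmp; exact: cvg_harmonic.
have h := ler_cvg_to limL limR (nearW _ close).
rewrite ler_pdivlMr ?pi_gt0// mulrC -[X in X * _](ger0_norm (pi_ge0 R)) -normrM.
by rewrite mulrBr [leRHS]mulrC; move: h; rewrite mulr0 addr0; apply.
Qed.

End stieltjes_inversion.

(** * Moments of the uniform distribution on the sphere *)

Section reflections.
Context {R : realType}.

Definition reflection n (v : 'rV[R]_n) : 'M[R]_n :=
  1%:M - (2 / (v *m v^T) 0 0) *: (v^T *m v).

Lemma reflection_orthogonal n (v : 'rV[R]_n) : (v *m v^T) 0 0 != 0 ->
  reflection v *m (reflection v)^T = 1%:M.
Proof.
set s := (v *m v^T) 0 0 => s0.
have sym : (reflection v)^T = reflection v.
  by rewrite /reflection linearB/= linearZ/= trmx1 trmx_mul trmxK.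
rewrite sym /reflection -/s mulmxBl mul1mx mulmxBr mulmx1 -scalemxAl -scalemxAr.
have -> : v^T *m v *m (v^T *m v) = s *: (v^T *m v).
  rewrite mulmxA -(mulmxA v^T) [v *m v^T]mx11_scalar -/s.
  by rewrite mul_mx_scalar -scalemxAl.
rewrite !scalerA (_ : 2 / s * (2 / s) * s = 2 / s + 2 / s); last by field.
by rewrite scalerDl opprB addrK subrK.
Qed.

Lemma mxact_reflection n (v : 'rV[R]_n) (x : n.-tuple (measurableTypeR R)) k :
  tnth (mxact (reflection v) x) k =
  tnth x k - 2 / (v *m v^T) 0 0 * v 0 k * \sum_(l < n) v 0 l * tnth x l.
Proof.
rewrite tnth_mktuple /reflection; set s := (v *m v^T) 0 0.
under eq_bigr => l _.
  rewrite !mxE big_ord1 !mxE mulrBl; over.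
rewrite big_split/= (bigD1 k)//= eqxx mul1r big1 ?addr0; last first.
  by move=> l lk; rewrite eq_sym (negbTE lk) mul0r.
congr (_ + _); rewrite sumrN mulr_sumr; congr (- _); apply: eq_bigr => l _.
by rewrite !ord1 !mulrA.
Qed.

End reflections.

Section sphere_moments.
Context {R : realType} (n : nat).
Local Notation Rn := (n.-tuple (measurableTypeR R)).
Local Notation S := (unit_sphere R n).
Implicit Types (x : Rn) (i j : 'I_n) (f g : Rn -> R).

Lemma measurable_coord i : measurable_fun [set: Rn] (fun x : Rn => (tnth x i : R)).
Proof. exact: measurable_tnth. Qed.

Lemma measurable_power_sum p :
  measurable_fun [set: Rn] (fun x : Rn => \sum_(i < n) (tnth x i : R) ^+ p).
Proof.
apply: measurable_sum => i; apply: measurable_funX; exact: measurable_coord.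
Qed.

Lemma measurable_sphere : measurable S.
Proof.
rewrite [X in measurable X](_ : _ =
    (fun x : Rn => \sum_(i < n) (tnth x i : R) ^+ 2) @^-1` [set 1])//.
rewrite -[X in measurable X]setTI; apply: measurable_power_sum => //.
Qed.

Lemma measurable_mxact (Q : 'M[R]_n) : measurable_fun [set: Rn] (@mxact R n Q).
Proof.
apply/measurable_fun_tnthP => i.
rewrite (_ : _ \o _ = (fun x : Rn => \sum_(j < n) Q i j * tnth x j)).
  apply: measurable_sum => j; apply: measurable_funM => //.
  exact: measurable_coord.
by apply/funext => x; rewrite /= tnth_mktuple.
Qed.

HB.instance Definition _ (Q : 'M[R]_n) :=
  isMeasurableFun.Build _ _ _ _ (@mxact R n Q) (measurable_mxact Q).

Lemma normr_coord_le1 x i : S x -> `|tnth x i| <= 1 :> R.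
Proof.
rewrite /unit_sphere/= => x1.
rewrite -(@expr_le1 _ 2)// real_normK ?num_real// -x1 (bigD1 i)//= lerDl.
by apply: sumr_ge0 => j _; exact: sqr_ge0.
Qed.

Variable sigma : probability Rn R.
Hypothesis sigma_unif : uniform_on_sphere sigma.

Let sigmaS : sigma (~` S) = 0%E.
Proof.
rewrite probability_setC; last exact: measurable_sphere.
by case: sigma_unif => -> _; rewrite subee.
Qed.

Lemma rintegrable_sphere f (M : R) : measurable_fun setT f ->
  (forall x, S x -> `|f x| <= M) -> rintegrable sigma f.
Proof.
move=> mf fM; apply/integrableP; split; first exact/measurable_EFinP.
have mS := measurable_sphere.
rewrite (@ge0_negligible_integral _ _ _ _ _ (~` S))//; first last.
- by apply: measurableT_comp => //; exact/measurable_EFinP.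
- exact: measurableC.
rewrite setTD setCK.
apply: (@le_lt_trans _ _ (\int[sigma]_(x in S) M%:E)%E).
  apply: ge0_le_integral => //.
  by apply: measurable_funTS; apply: measurableT_comp => //; exact/measurable_EFinP.
by rewrite integral_cst//= (_ : sigma S = 1%E) ?mule1 ?ltry//; case: sigma_unif.
Qed.

Lemma eq_rintegral_sphere f g : measurable_fun setT f -> measurable_fun setT g ->
  (forall x, S x -> f x = g x) -> \int[sigma]_x f x = \int[sigma]_x g x.
Proof.
move=> mf mg fg; congr fine; apply: ae_eq_integral => //;
  try exact/measurable_EFinP.
exists (~` S); split => //; first by apply: measurableC; exact: measurable_sphere.
by move=> x /=; apply: contra_not => Sx _; rewrite fg.
Qed.

Lemma rintegral_mxact (Q : 'M[R]_n) f : Q *m Q^T = 1%:M -> rintegrable sigma f ->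
  \int[sigma]_x f (mxact Q x) = \int[sigma]_x f x.
Proof.
move=> QQ f_i; have mf := rintegrable_measurable f_i.
have same (h : Rn -> \bar R) :
    (\int[distribution sigma (mxact Q)]_x h x = \int[sigma]_x h x)%E.
  by apply: eq_measure_integral => A mA _; case: sigma_unif => _ /(_ Q QQ A mA).
rewrite /Rintegral -[in RHS]same integral_distribution//.
  exact/measurable_EFinP.
apply/integrableP; split.
  by apply/measurable_EFinP; exact: measurableT_comp.
have := @ge0_integral_distribution _ _ _ _ _ sigma (mxact Q)
  (fun x => `|(f x)%:E|%E).
move=> /= <-//; first by rewrite same; case/integrableP: f_i.
by apply/measurable_EFinP; exact: measurableT_comp.
Qed.

Lemma rintegral_sum m (F : 'I_m -> Rn -> R) :
  (forall k, rintegrable sigma (F k)) ->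
  rintegrable sigma (fun x => \sum_(k < m) F k x) /\
  \int[sigma]_x (\sum_(k < m) F k x) = \sum_(k < m) \int[sigma]_x F k x.
Proof.
elim: m F => [F _|m IH F iF].
  rewrite big_ord0; under [X in rintegrable _ X]eq_fun do rewrite big_ord0.
  under eq_Rintegral do rewrite big_ord0.
  by split; [exact: rintegrable_cst|rewrite rintegral_cst].
have [i1 e1] := IH (fun k => F (widen_ord (leqnSn m) k))
  (fun k => iF (widen_ord (leqnSn m) k)).
have eF : (fun x => \sum_(k < m.+1) F k x) =
    (fun x => \sum_(k < m) F (widen_ord (leqnSn m) k) x + F ord_max x).
  by apply/funext => x; rewrite big_ord_recr.
by rewrite eF big_ord_recr/= -e1; split; [exact: rintegrableD|rewrite rintegralD].
Qed.

Definition moment2 i j (p q : nat) : R :=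
  \int[sigma]_x ((tnth x i : R) ^+ p * (tnth x j : R) ^+ q).

Lemma measurable_monomial i j p q : measurable_fun [set: Rn]
  (fun x : Rn => (tnth x i : R) ^+ p * (tnth x j : R) ^+ q).
Proof. by apply: measurable_funM; apply: measurable_funX; exact: measurable_coord. Qed.

Lemma rintegrable_monomial i j p q :
  rintegrable sigma (fun x : Rn => (tnth x i : R) ^+ p * (tnth x j : R) ^+ q).
Proof.
apply: (rintegrable_sphere (M := 1)); first exact: measurable_monomial.
move=> x Sx; rewrite normrM !normrX mulr_ile1 ?exprn_ge0//;
  by rewrite exprn_ile1// normr_coord_le1.
Qed.

Lemma moment2C i j p q : moment2 i j p q = moment2 j i q p.
Proof. by apply: eq_Rintegral => x _; rewrite mulrC. Qed.

Lemma moment2_diag i p q : moment2 i i p q = moment2 i i (p + q) 0.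
Proof. by apply: eq_Rintegral => x _; rewrite -exprD mulr1. Qed.

(** The reflection [x_i -> - x_i] kills the moments of odd degree in [x_i]. *)
Lemma moment2_odd i j p q : i != j -> odd p -> moment2 i j p q = 0.
Proof.
move=> ij p_odd; set v : 'rV[R]_n := delta_mx 0 i.
have vv : (v *m v^T) 0 0 = 1.
  by rewrite /v trmx_delta mul_delta_mx mxE !eqxx.
have Q1 : reflection v *m (reflection v)^T = 1%:M.
  by rewrite reflection_orthogonal// vv oner_neq0.
have sumv (x : Rn) : \sum_(l < n) v 0 l * tnth x l = tnth x i.
  rewrite (bigD1 i)//= mxE !eqxx mul1r big1 ?addr0// => l li.
  by rewrite mxE (negbTE li) andbF mul0r.
have := rintegral_mxact Q1 (rintegrable_monomial i j p q).
under eq_Rintegral => x _.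
  rewrite !mxact_reflection vv sumv !mxE !eqxx [j == i]eq_sym (negbTE ij) andbF/=.
  rewrite mulr0 mul0r subr0 divr1 mulr1 (_ : tnth x i - _ = - tnth x i); last by ring.
  rewrite exprNn -signr_odd p_odd expr1 mulN1r mulNr -mulN1r.
  over.
rewrite rintegralZ; last exact: rintegrable_monomial.
by rewrite -/(moment2 i j p q); lra.
Qed.

(** The vector [e_i + (1 + sqrt 2) e_j] makes an angle [3 pi / 8] with [e_i], so
    that the corresponding reflection mixes the coordinates [i] and [j] with
    equal weights. *)
Lemma moment2_reflect i j p q : i != j ->
  moment2 i j p q =
  \int[sigma]_x (((Num.sqrt 2)^-1 * (tnth x i - tnth x j)) ^+ p *
                 (- (Num.sqrt 2)^-1 * (tnth x i + tnth x j)) ^+ q).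
Proof.
move=> ij; set s : R := Num.sqrt 2.
have s2 : s ^+ 2 = 2 by rewrite sqr_sqrtr.
have s0 : 0 < s by rewrite sqrtr_gt0.
set v : 'rV[R]_n := delta_mx 0 i + (1 + s) *: delta_mx 0 j.
have vi : v 0 i = 1.
  by rewrite !mxE !eqxx (negbTE ij) /= mulr0 addr0.
have vj : v 0 j = 1 + s.
  by rewrite !mxE !eqxx eq_sym (negbTE ij) /= mulr1 add0r.
have sumv (f : 'I_n -> R) : \sum_(l < n) v 0 l * f l = f i + (1 + s) * f j.
  rewrite (bigD1 i)//= vi mul1r (bigD1 j) 1?eq_sym//= vj big1 ?addr0//.
  move=> l /andP[li lj]; rewrite !mxE (negbTE li) (negbTE lj) !andbF.
  by rewrite mulr0 addr0 mul0r.
have vv : (v *m v^T) 0 0 = 4 + 2 * s.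
  rewrite mxE; under eq_bigr do rewrite [in X in _ * X]mxE.
  by rewrite (sumv (v 0)) vi vj; lra.
have vv0 : 4 + 2 * s != 0 by rewrite gt_eqF//; lra.
have Q1 : reflection v *m (reflection v)^T = 1%:M.
  by rewrite reflection_orthogonal// vv.
have sV : s^-1 = s / 2 by rewrite -s2; field; rewrite gt_eqF.
have kE : 2 / (4 + 2 * s) = 1 - s / 2.
  by apply: (mulIf vv0); rewrite divfK//; lra.
apply: etrans (esym (rintegral_mxact Q1 (rintegrable_monomial i j p q))) _.
apply: eq_Rintegral => x _; rewrite !mxact_reflection vv kE vi vj.
rewrite (sumv (fun l => tnth x l : R)) sV.
move: (tnth x i : R) (tnth x j : R) => y z.
have s2y : (s ^+ 2 - 2) * y = 0 by rewrite s2 subrr mul0r.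
have s2z : (s ^+ 2 - 2) * z = 0 by rewrite s2 subrr mul0r.
have s3z : (s ^+ 2 - 2) * s * z = 0 by rewrite s2 subrr !mul0r.
by congr (_ ^+ _ * _ ^+ _); lra.
Qed.

Lemma rintegral_linear_power i j (a b : R) m :
  rintegrable sigma (fun x => (a * tnth x i + b * tnth x j) ^+ m) /\
  \int[sigma]_x (a * tnth x i + b * tnth x j) ^+ m =
  \sum_(k < m.+1) (a ^+ (m - k) * b ^+ k *+ 'C(m, k)) * moment2 i j (m - k) k.
Proof.
pose F (k : 'I_m.+1) (x : Rn) : R := (a ^+ (m - k) * b ^+ k *+ 'C(m, k)) *
  ((tnth x i : R) ^+ (m - k) * (tnth x j : R) ^+ k).
have iF k : rintegrable sigma (F k).
  by apply: rintegrableZ; exact: rintegrable_monomial.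
have expand (x : Rn) : (a * tnth x i + b * tnth x j) ^+ m = \sum_(k < m.+1) F k x.
  rewrite exprDn; apply: eq_bigr => k _.
  by rewrite /F !exprMn -mulr_natr -[in RHS]mulr_natr; ring.
have [iS eS] := rintegral_sum iF.
split; first by rewrite (funext expand).
transitivity (\int[sigma]_x (\sum_(k < m.+1) F k x)).
  by apply: eq_Rintegral => x _; exact: expand.
rewrite eS; apply: eq_bigr => k _.
by rewrite rintegralZ//; exact: rintegrable_monomial.
Qed.

(** Averaging [x_i^m + x_j^m] over the reflection relates the pure moments to
    the mixed ones. *)
Lemma moment2_reflect_sum i j h : i != j ->
  2 ^+ h * (moment2 i j h.*2 0 + moment2 i j 0 h.*2) =
  \sum_(k < h.*2.+1) (((- 1) ^+ k + 1) *+ 'C(h.*2, k)) * moment2 i j (h.*2 - k) k.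
Proof.
move=> ij; rewrite (moment2_reflect _ 0 ij) (moment2_reflect 0 _ ij).
set s : R := Num.sqrt 2; set m := h.*2.
have sm : s ^+ m = 2 ^+ h by rewrite /m -mul2n exprM sqr_sqrtr.
have s0 : s != 0 by rewrite gt_eqF// sqrtr_gt0.
have pure (b : R) : \int[sigma]_x ((s^-1 * (tnth x i + b * tnth x j)) ^+ m) =
    2 ^- h * \sum_(k < m.+1) (b ^+ k *+ 'C(m, k)) * moment2 i j (m - k) k.
  have [iL eL] := rintegral_linear_power i j 1 b m.
  transitivity (s ^- m * \int[sigma]_x (1 * tnth x i + b * tnth x j) ^+ m).
    rewrite -rintegralZ//.
    by apply: eq_Rintegral => x _; rewrite exprMn exprVn mul1r.
  rewrite sm eL; congr (_ * _).
  by apply: eq_bigr => k _; rewrite expr1n mul1r.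
have e1 : \int[sigma]_x ((s^-1 * (tnth x i - tnth x j)) ^+ m *
    (- s^-1 * (tnth x i + tnth x j)) ^+ 0) =
    2 ^- h * \sum_(k < m.+1) ((- 1) ^+ k *+ 'C(m, k)) * moment2 i j (m - k) k.
  rewrite -pure; apply: eq_Rintegral => x _.
  by rewrite expr0 mulr1 mulN1r.
have e2 : \int[sigma]_x ((s^-1 * (tnth x i - tnth x j)) ^+ 0 *
    (- s^-1 * (tnth x i + tnth x j)) ^+ m) =
    2 ^- h * \sum_(k < m.+1) (1 ^+ k *+ 'C(m, k)) * moment2 i j (m - k) k.
  rewrite -pure; apply: eq_Rintegral => x _.
  by rewrite expr0 !mul1r mulNr exprNn -signr_odd odd_double mul1r.
rewrite e1 e2 -mulrDr mulrA mulfV ?mul1r ?expf_neq0 ?pnatr_eq0//.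
by rewrite -big_split/=; apply: eq_bigr => k _; rewrite expr1n mulrnDl mulrDl.
Qed.

Lemma moment2_pure i j m :
  moment2 i j m 0 = moment2 i i m 0 /\ moment2 i j 0 m = moment2 j j m 0.
Proof.
by split; apply: eq_Rintegral => x _; rewrite !expr0 ?mul1r ?mulr1.
Qed.

(** The diagonal term makes the relation valid for [i = j] too, so that it can
    be summed over all pairs. *)
Lemma moment2_fourth i j :
  6 * moment2 i j 2 2 =
  moment2 i i 4 0 + moment2 j j 4 0 + (4 * moment2 i i 4 0) *+ (i == j).
Proof.
have [<-|ij] := eqVneq i j; first by rewrite moment2_diag mulr1n; ring.
have := moment2_reflect_sum 2 ij.
rewrite !big_ord_recl big_ord0 /= /bump /= !(add1n, subSS, subn0).
rewrite (_ : 'C(4, 0) = 1)%N // (_ : 'C(4, 2) = 6)%N // (_ : 'C(4, 4) = 1)%N //.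
have [-> ->] := moment2_pure i j 4; rewrite !exprS expr0 mulr0n; lra.
Qed.

Lemma moment2_sixth i j :
  5 * (moment2 i j 4 2 + moment2 i j 2 4) =
  moment2 i i 6 0 + moment2 j j 6 0 + (8 * moment2 i i 6 0) *+ (i == j).
Proof.
have [<-|ij] := eqVneq i j.
  by rewrite (moment2_diag i 4 2) (moment2_diag i 2 4) mulr1n; ring.
have := moment2_reflect_sum 3 ij.
rewrite !big_ord_recl big_ord0 /= /bump /= !(add1n, subSS, subn0).
rewrite (_ : 'C(6, 0) = 1)%N // (_ : 'C(6, 2) = 15)%N //.
rewrite (_ : 'C(6, 4) = 15)%N // (_ : 'C(6, 6) = 1)%N //.
have [-> ->] := moment2_pure i j 6; rewrite !exprS expr0 mulr0n; lra.
Qed.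

Lemma rintegral_double_sum (F : 'I_n -> 'I_n -> Rn -> R) :
  (forall i j, rintegrable sigma (F i j)) ->
  rintegrable sigma (fun x => \sum_(i < n) \sum_(j < n) F i j x) /\
  \int[sigma]_x (\sum_(i < n) \sum_(j < n) F i j x) =
  \sum_(i < n) \sum_(j < n) \int[sigma]_x F i j x.
Proof.
move=> iF.
have [i1 ->] := rintegral_sum (fun i => (rintegral_sum (iF i)).1).
by split => //; apply: eq_bigr => i _; rewrite (rintegral_sum (iF i)).2.
Qed.

Let A := \sum_(i < n) moment2 i i 4 0.
Let S6 := \sum_(i < n) moment2 i i 6 0.

Let sum_diag (f : 'I_n -> R) :
  \sum_(i < n) \sum_(j < n) f i *+ (i == j) = \sum_(i < n) f i.
Proof.
apply: eq_bigr => i _; rewrite (bigD1 i)//= eqxx big1 ?addr0// => j ji.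
by rewrite eq_sym (negbTE ji).
Qed.

Let sum_l (f : 'I_n -> R) :
  \sum_(i < n) \sum_(j < n) f i = n%:R * \sum_(i < n) f i.
Proof.
rewrite mulr_sumr; apply: eq_bigr => i _.
by rewrite sumr_const card_ord mulr_natl.
Qed.

Let sum_r (f : 'I_n -> R) :
  \sum_(i < n) \sum_(j < n) f j = n%:R * \sum_(i < n) f i.
Proof. by rewrite sumr_const card_ord mulr_natl. Qed.

(** The fourth and sixth moments follow by integrating the identities
    [(\sum x_i^2)^2 = 1] and [\sum x_i^4 \sum x_j^2 = \sum x_i^4]. *)
Lemma sphere_fourth_moment : (n%:R + 2) * A = 3.
Proof.
have [_ e] := rintegral_double_sum (fun i j => rintegrable_monomial i j 2 2).
have e1 : \sum_(i < n) \sum_(j < n) moment2 i j 2 2 = 1.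
  rewrite -e -[RHS](rintegral_cst sigma 1); apply: eq_rintegral_sphere => //.
    apply: measurable_sum => i; apply: measurable_sum => j.
    exact: measurable_monomial.
  move=> x Sx; rewrite -[RHS]mulr1 -{1}Sx -Sx mulr_suml.
  by apply: eq_bigr => i _; rewrite mulr_sumr.
have : 6 * \sum_(i < n) \sum_(j < n) moment2 i j 2 2 =
    n%:R * A + n%:R * A + 4 * A.
  rewrite mulr_sumr; under eq_bigr => i _.
    rewrite mulr_sumr; under eq_bigr do rewrite moment2_fourth.
    rewrite !big_split/=; over.
  by rewrite !big_split/= sum_l sum_r sum_diag -mulr_sumr.
rewrite e1; lra.
Qed.

Lemma sphere_sixth_moment : (n%:R + 4) * S6 = 5 * A.
Proof.
have [_ e] := rintegral_double_sum (fun i j => rintegrable_monomial i j 4 2).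
have e1 : \sum_(i < n) \sum_(j < n) moment2 i j 4 2 = A.
  rewrite -e /A -(rintegral_sum (fun i => rintegrable_monomial i i 4 0)).2.
  apply: eq_rintegral_sphere.
  - apply: measurable_sum => i; apply: measurable_sum => j.
    exact: measurable_monomial.
  - by apply: measurable_sum => i; exact: measurable_monomial.
  move=> x Sx; apply: eq_bigr => i _.
  by rewrite -mulr_sumr expr0; congr (_ * _).
have e2 : \sum_(i < n) \sum_(j < n) moment2 i j 2 4 = A.
  rewrite exchange_big /= -[RHS]e1; apply: eq_bigr => i _; apply: eq_bigr => j _.
  by rewrite moment2C.
have : 5 * (\sum_(i < n) \sum_(j < n) moment2 i j 4 2 +
            \sum_(i < n) \sum_(j < n) moment2 i j 2 4) =
    n%:R * S6 + n%:R * S6 + 8 * S6.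
  rewrite -big_split mulr_sumr; under eq_bigr => i _.
    rewrite -big_split mulr_sumr; under eq_bigr do rewrite moment2_sixth.
    rewrite !big_split/=; over.
  by rewrite !big_split/= sum_l sum_r sum_diag -mulr_sumr.
rewrite e1 e2; lra.
Qed.

(** By the sign symmetry the cubes [x_i^3] are uncorrelated. *)
Lemma sphere_cubes :
  rintegrable sigma (fun x : Rn => (\sum_(i < n) (tnth x i : R) ^+ 3) ^+ 2) /\
  \int[sigma]_x (\sum_(i < n) (tnth x i : R) ^+ 3) ^+ 2 = S6.
Proof.
have [i e] := rintegral_double_sum (fun i j => rintegrable_monomial i j 3 3).
have expand (x : Rn) : (\sum_(i < n) (tnth x i : R) ^+ 3) ^+ 2 =
    \sum_(i < n) \sum_(j < n) ((tnth x i : R) ^+ 3 * (tnth x j : R) ^+ 3).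
  rewrite expr2 mulr_suml; apply: eq_bigr => k _; exact: mulr_sumr.
split; first by rewrite (funext expand).
under eq_Rintegral do rewrite expand.
rewrite e -[RHS]sum_diag; apply: eq_bigr => k _; apply: eq_bigr => l _.
rewrite -/(moment2 k l 3 3); have [<-|kl] := eqVneq k l.
  by rewrite moment2_diag.
by rewrite (moment2_odd 3 kl (isT : odd 3)).
Qed.

(** Both [n \sum x_i^3] and [n \sum x_i^4] are bounded in probability, by
    Markov's inequality for a single test function. *)
Lemma sphere_typical (rho : R) : (0 < n)%N -> 0 < rho ->
  let F := S `&` [set x : Rn |
    n%:R ^+ 2 * (\sum_(i < n) (tnth x i : R) ^+ 3) ^+ 2 +
    n%:R * \sum_(i < n) (tnth x i : R) ^+ 4 < 18 / rho] in
  [/\ measurable F, F `<=` S & ((1 - rho)%:E <= sigma F)%E].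
Proof.
move=> n0 rho0 F.
pose f (x : Rn) : R := n%:R ^+ 2 * (\sum_(i < n) (tnth x i : R) ^+ 3) ^+ 2 +
  n%:R * \sum_(i < n) (tnth x i : R) ^+ 4.
set L := 18 / rho.
have L0 : 0 < L by rewrite divr_gt0.
have [i3 e3] := sphere_cubes.
have [i4 e4] := rintegral_sum (fun i => rintegrable_monomial i i 4 0).
have eq4 : (fun x : Rn => \sum_(i < n) (tnth x i : R) ^+ 4) =
    (fun x => \sum_(i < n) ((tnth x i : R) ^+ 4 * (tnth x i : R) ^+ 0)).
  by apply/funext => x; apply: eq_bigr => i _; rewrite mulr1.
have i4' : rintegrable sigma (fun x : Rn => \sum_(i < n) (tnth x i : R) ^+ 4).
  by rewrite eq4.
have if_ : rintegrable sigma f by apply: rintegrableD; exact: rintegrableZ.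
have f0 x : 0 <= f x.
  apply: addr_ge0; apply: mulr_ge0; rewrite ?sqr_ge0//.
  by apply: sumr_ge0 => i _; rewrite exprn_even_ge0.
have Ef : \int[sigma]_x f x <= 18.
  rewrite rintegralD; [|exact: rintegrableZ|exact: rintegrableZ].
  rewrite !rintegralZ// e3 (_ : \int[sigma]_x _ = A); last by rewrite eq4 e4.
  have A0 : 0 <= A.
    apply: sumr_ge0 => i _; apply: Rintegral_ge0 => x _.
    by rewrite mulr1 exprn_even_ge0.
  have S0 : 0 <= S6.
    apply: sumr_ge0 => i _; apply: Rintegral_ge0 => x _.
    by rewrite mulr1 exprn_even_ge0.
  have h4 := sphere_fourth_moment; have h6 := sphere_sixth_moment.
  have nA : n%:R * A <= 3 by lra.
  have nS : n%:R * S6 <= 5 * A by lra.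
  have : n%:R * (n%:R * S6) <= n%:R * (5 * A) by rewrite ler_wpM2l.
  lra.
pose B := [set x | L <= f x].
have mf : measurable_fun setT f by exact: rintegrable_measurable if_.
have mB : measurable B.
  rewrite (_ : B = setT `&` f @^-1` `[L, +oo[%classic).
    by apply: mf => //; exact: measurable_itv.
  by apply/seteqP; split => x; rewrite /B/= in_itv/= andbT => // -[].
have FE : F = S `&` ~` B.
  apply/seteqP; split => x [Sx].
    by move=> fL; split => //; apply/negP; rewrite -ltNge.
  by move=> /negP; rewrite -ltNge => fL; split.
have mS := measurable_sphere.
have mF : measurable F by rewrite FE; apply: measurableI => //; exact: measurableC.
split => //; first by move=> x [].
have mu_B : fine (sigma B) <= rho.
  have : L * fine (sigma B) <= 18.
    apply: le_trans Ef.
    have iB : rintegrable sigma (\1_B : Rn -> R) by exact: integrable_indic.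
    have -> : fine (sigma B) = \int[sigma]_x (\1_B x : R).
      by rewrite /Rintegral integral_indic// setIT.
    rewrite -rintegralZ//; apply: rintegral_le => //; first exact: rintegrableZ.
    move=> x; rewrite indicE; case: (boolP (x \in B)) => xB; rewrite ?mulr1 ?mulr0//.
    by move: xB; rewrite inE.
  by rewrite /L mulrAC ler_pdivrMr// ler_pM2l.
have : (sigma (~` F) <= sigma B)%E.
  rewrite -[leRHS]add0e -sigmaS FE setCI setCK.
  by apply: measureU2 => //; exact: measurableC.
rewrite probability_setC// -(fineK (fin_num_measure sigma _ mF)).
rewrite -(fineK (fin_num_measure sigma _ mB)) -EFinB !lee_fin; lra.
Qed.

End sphere_moments.

(** * Rate of convergence to the semicircle law *)

Section moments.
Context {R : realType} (mu : probR R).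

Lemma rintegrable_power m k : (abs_moment mu m < +oo)%E -> (k <= m)%N ->
  rintegrable mu (fun t => t ^+ k).
Proof.
move=> mu_m km.
have im : rintegrable mu (fun t : measurableTypeR R => `|t : R| ^+ m).
  apply/integrableP; split.
    by apply/measurable_EFinP; apply: measurable_funX; exact: normr_measurable.
  apply: le_lt_trans mu_m; rewrite le_eqVlt; apply/orP; left; apply/eqP.
  by apply: eq_integral => t _ /=; rewrite ger0_norm// exprn_ge0.
apply: (rintegrable_le (g := fun t : measurableTypeR R => 1 + `|t : R| ^+ m)).
- exact: exprn_measurable.
- move=> t; rewrite normrX; have [t1|t1] := leP `|t : R| 1.
    by rewrite (le_trans (exprn_ile1 _ (normr_ge0 _) t1))// lerDl exprn_ge0.
  by rewrite (le_trans (ler_weXn2l (ltW t1) km))// lerDr.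
- by apply: rintegrableD => //; exact: rintegrable_cst.
Qed.

Lemma standardized_moments : ('E_mu[@idfun R] = 0)%E -> ('V_mu[@idfun R] = 1)%E ->
  (abs_moment mu 6 < +oo)%E ->
  standardized mu (fine (abs_moment mu 3)) (fine (abs_moment mu 4)).
Proof.
move=> E0 V1 m6.
have abs_momentE k : fine (abs_moment mu k) = \int[mu]_t `|t ^+ k|.
  by apply: eq_Rintegral => t _; rewrite normrX.
split.
- by move=> k k4; apply: (rintegrable_power m6); exact: leq_trans k4 _.
- move: E0; rewrite unlock /= => E0; rewrite /Rintegral.
  by under eq_integral do rewrite expr1; rewrite E0.
- move: V1; rewrite /variance unlock E0 unlock /= => V1; rewrite /Rintegral.
  rewrite (_ : (\int[mu]_x (x ^+ 2)%:E)%E = 1%E)// -V1.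
  apply: eq_integral => t _; congr EFin.
  by rewrite -[RHS]/(((t : R) - 0) * ((t : R) - 0)) subr0 expr2.
- by rewrite abs_momentE.
- by rewrite abs_momentE.
Qed.

End moments.

Section semicircle_deviation.
Context {R : realType}.

(** This is [n] times a bound for the residual of the quadratic equation at
    typical weights: [k] is the inverse of the barrier [eps / 16], and there
    [n |\sum theta_i^3| <= 1 + L] and [n \sum theta_i^4 <= L]. *)
Definition deviation_constant (eps rho b3 b4 : R) : R :=
  let k := (eps / 16)^-1 in let L := 18 / rho in
  b3 * k ^+ 3 * (1 + L) + (3 + 7 * b3 + b4) * k ^+ 5 * L.

(** Integrating the estimate [2 eta / (pi eps)] for the densities over an interval
    of length at most 4. *)
Lemma Delta_semicircle_le (mu nu : probR R) (b3 b4 eps eta : R) (n : nat)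
    (theta : 'I_n -> R) :
  standardized mu b3 b4 -> 0 < eps < 1 -> eta <= eps / 24 ->
  (forall i, 7 * theta i ^+ 2 <= (eps / 16) ^+ 3) ->
  \sum_(i < n) theta i ^+ 2 = 1 ->
  b3 * (eps / 16)^-1 ^+ 3 * `|\sum_(i < n) theta i ^+ 3| +
    (3 + 7 * b3 + b4) * (eps / 16)^-1 ^+ 5 * \sum_(i < n) theta i ^+ 4 <= eta ->
  is_free_convolution (fun i => dilate (theta i) mu) nu ->
  Delta eps nu semicircle <= 8 * eta / eps.
Proof.
move=> mu_std epsP eta_eps th7 th2 resid conv.
have /andP[eps0 eps1] := epsP.
apply: ge_sup.
  exists (`| fine (nu `]- 2 + eps, (0 : R)]%classic) -
      fine (semicircle `]- 2 + eps, (0 : R)]%classic) |).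
  by exists 0 => //=; rewrite in_itv/=; apply/andP; split; lra.
move=> _ [x /= + <-]; rewrite in_itv/= => /andP[ax xb].
have bound y t : - 2 + eps <= y <= x -> 0 < t -> t <= 1 ->
    `| - complex.Im (cauchy_transform nu (Complex y t)) - pi * semicircle_pdf y |
    <= 2 * eta / eps + 8 / eps * t.
  move=> /andP[ay yx] t0 t1.
  have -> : pi * semicircle_pdf y = Num.sqrt (4 - y ^+ 2) / 2.
    rewrite /semicircle_pdf; have := pi_gt0 R; move: (@pi R) => p p0.
    by field; rewrite gt_eqF.
  have -> : 2 * eta / eps + 8 / eps * t = 2 * (eta + 4 * t) / eps.
    by field; rewrite gt_eqF.
  apply: (cauchy_transform_interior mu_std epsP eta_eps th7 th2 resid conv) => //.
  by rewrite ler_norml; apply/andP; split; lra.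
have := stieltjes_density_bound ax (@continuous_semicircle_pdf R) bound.
move=> /le_trans; apply.
have eta0 : 0 <= eta.
  have [b30 b40] := standardized_ge0 mu_std.
  apply: le_trans resid; apply: addr_ge0.
    by rewrite !mulr_ge0 ?exprn_ge0 ?invr_ge0 ?divr_ge0// ltW.
  apply: mulr_ge0; last by apply: sumr_ge0 => i _; rewrite exprn_even_ge0.
  by rewrite mulr_ge0 ?exprn_ge0 ?invr_ge0 ?divr_ge0 ?(ltW eps0)//; lra.
have e0 : 0 <= eta / eps by rewrite divr_ge0// ltW.
rewrite ler_pdivrMr ?pi_gt0// -!mulrA.
have pi1 := @pi_ge2 R.
have : 8 * (eta / eps) <= 8 * (eta / eps * pi).
  by rewrite ler_pM2l// ler_peMr//; lra.
have : (x - (- 2 + eps)) * (2 * (eta / eps)) <= 4 * (2 * (eta / eps)).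
  by rewrite ler_wpM2r//; lra.
lra.
Qed.

End semicircle_deviation.

Theorem theorem1p3 (R : realType)
    (sigma : forall n, probability (n.-tuple (measurableTypeR R)) R)
    (sigma_unif : forall n, (0 < n)%N -> uniform_on_sphere (sigma n)) :
  exists C : R -> R -> 6.-tuple R -> R,
  forall mu : probR R,
    ('E_mu[@idfun R] = 0)%E ->
    ('V_mu[@idfun R] = 1)%E ->
    (abs_moment mu 6 < +oo)%E ->
  forall eps rho : R, 0 < eps < 1 -> 0 < rho < 1 ->
  let K := C eps rho [tuple fine (abs_moment mu k.+1) | k < 6] in
  0 < K /\
  exists (n0 : nat) (F : forall n, set (n.-tuple (measurableTypeR R))),
    (forall n, (0 < n)%N ->
      [/\ measurable (F n), F n `<=` unit_sphere R n
        & ((1 - rho)%:E <= sigma n (F n))%E]) /\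
    (forall n, (0 < n)%N -> (n0 <= n)%N ->
      forall theta, F n theta ->
      forall mu_theta : probR R,
        is_free_convolution (fun i => dilate (tnth theta i) mu) mu_theta ->
        Delta eps mu_theta semicircle <= K / n%:R).
Proof.
exists (fun eps rho M => 8 * deviation_constant eps rho
  (tnth M (inord 2)) (tnth M (inord 3)) / eps).
move=> mu E0 V1 m6 eps rho epsP /andP[rho0 rho1] K.
have mu_std := standardized_moments E0 V1 m6.
have /andP[eps0 eps1] := epsP.
set b3 := fine (abs_moment mu 3) in mu_std.
set b4 := fine (abs_moment mu 4) in mu_std.
have [b30 b40] := standardized_ge0 mu_std.
pose K1 := deviation_constant eps rho b3 b4.
have KE : K = 8 * K1 / eps.
  by rewrite /K !tnth_mktuple !inordK.
pose c := eps / 16; pose L := 18 / rho.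
have c0 : 0 < c by rewrite divr_gt0.
have L0 : 0 < L by rewrite divr_gt0.
have K10 : 0 < K1.
  rewrite /K1 /deviation_constant -/c -/L; apply: ltr_wpDl.
    by rewrite !mulr_ge0 ?exprn_ge0 ?invr_ge0 ?(ltW c0)//; lra.
  by rewrite !mulr_gt0 ?exprn_gt0 ?invr_gt0//; lra.
split; first by rewrite KE divr_gt0// mulr_gt0.
(* The first term makes the residual at most [eps / 24]; the second one makes
   every [theta_i^2] at most [(eps / 16)^3 / 7]. *)
pose n0 := Num.bound (24 * K1 / eps + 49 * L / c ^+ 6).
exists n0, (fun n => unit_sphere R n `&` [set x : n.-tuple (measurableTypeR R) |
  n%:R ^+ 2 * (\sum_(i < n) (tnth x i : R) ^+ 3) ^+ 2 +
  n%:R * \sum_(i < n) (tnth x i : R) ^+ 4 < 18 / rho]); split.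
  by move=> n n_gt0; exact: sphere_typical (sigma_unif n n_gt0) _ n_gt0 rho0.
move=> n n_gt0 n0n theta [theta1 typical] nu conv.
pose th i : R := tnth theta i.
pose N : R := n%:R.
have N0 : 0 < N by rewrite ltr0n.
have p1 : 0 < 24 * K1 / eps by rewrite divr_gt0// mulr_gt0.
have p2 : 0 < 49 * L / c ^+ 6 by rewrite divr_gt0 ?exprn_gt0// mulr_gt0.
have bigN : 24 * K1 / eps + 49 * L / c ^+ 6 < N.
  apply: (@lt_le_trans _ _ n0%:R); last by rewrite ler_nat.
  by apply: archi_boundP; rewrite addr_ge0// ltW.
have KN : 24 * K1 / eps < N by lra.
have LN : 49 * L / c ^+ 6 < N by lra.
set s3 := \sum_(i < n) th i ^+ 3; set s4 := \sum_(i < n) th i ^+ 4.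
have typ : N ^+ 2 * s3 ^+ 2 + N * s4 < L by exact: typical.
have s40 : 0 <= s4 by apply: sumr_ge0 => i _; rewrite exprn_even_ge0.
have Ns4 : N * s4 <= L.
  have : 0 <= N ^+ 2 * s3 ^+ 2 by rewrite mulr_ge0 ?sqr_ge0.
  lra.
have Ns3 : N * `|s3| <= 1 + L.
  have : (N * `|s3|) ^+ 2 <= L.
    rewrite exprMn real_normK ?num_real//.
    have : 0 <= N * s4 by rewrite mulr_ge0// ltW.
    lra.
  have := sqr_ge0 (N * `|s3| - 1); rewrite sqrrB1 mulr2n expr2; lra.
have -> : K / n%:R = 8 * (K1 / N) / eps.
  by rewrite KE /N; field; rewrite !gt_eqF.
apply: (Delta_semicircle_le (theta := th) mu_std epsP) => //.
- rewrite ler_pdivrMr// mulrC -ler_pdivrMr ?divr_gt0//.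
  have -> : K1 / (eps / 24) = 24 * K1 / eps by field; rewrite gt_eqF.
  exact: ltW.
(* A single weight is controlled by [theta_i^4 <= \sum theta_j^4]. *)
- move=> i; rewrite -/c -(ler_pXn2r (_ : 0 < 2)%N) ?nnegrE ?exprn_ge0//; last 2 first.
  + by rewrite mulr_ge0// sqr_ge0.
  + exact: ltW.
  rewrite -exprM exprMn -exprM.
  have th4 : th i ^+ 4 <= s4.
    by rewrite /s4 (bigD1 i)//= lerDl; apply: sumr_ge0 => j _; rewrite exprn_even_ge0.
  have : N * th i ^+ 4 <= L by apply: le_trans Ns4; rewrite ler_pM2l.
  move: LN; rewrite ltr_pdivrMr ?exprn_gt0// => LN Nth.
  have : N * (49 * th i ^+ 4) <= N * c ^+ 6 by lra.
  by rewrite ler_pM2l//; lra.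
- rewrite -/c -/s3 -/s4 ler_pdivlMr// /K1 /deviation_constant -/c -/L.
  rewrite mulrDl -!(mulrA _ _ N) [`|s3| * N]mulrC [s4 * N]mulrC.
  have bk : 0 <= b3 * c^-1 ^+ 3 by rewrite mulr_ge0 ?exprn_ge0 ?invr_ge0 ?(ltW c0).
  apply: lerD; first exact: ler_wpM2l.
  apply: ler_wpM2l => //.
  by rewrite mulr_ge0 ?exprn_ge0 ?invr_ge0 ?(ltW c0)//; lra.
Qed.
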